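(* Let $0<q<1$, let $a,b,c,d$ be nonzero complex numbers with $|a|,|b|,|c|,|d|<1$, and let $0\le k,m\le n$ be integers. Define $$J_m(k)=\frac1{2\pi}\int_0^\pi p_m(\cos\theta;a,b,c,d\,|\,q)\,w\bigl(\cos\theta;aq^{k},bq^{n-k},c,d\bigr)\,d\theta .$$ Let $C_m(n,k)$ be the coefficients of the expansion $\widetilde{\mathcal B}^{\,n}_k(x;a,b)=\sum_{m=0}^nC_m(n,k)\,p_m(x;a,b,c,d\,|\,q)$. Then $$\bigl\langle\widetilde{\mathcal B}^{\,n}_k,\,p_m\bigr\rangle_{a,b,c,d}=\binom nk J_m(k),\qquad C_m(n,k)=\frac{\binom nk}{h_m}\,J_m(k).$$ In particular, the index $k$ enters the connection coefficients (apart from the factor $\binom nk$) only through the shifted parameters $aq^k$ and $bq^{n-k}$ of the weight.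
   Context: Notation: $(c;q)_k=\prod_{j=0}^{k-1}(1-cq^j)$, $(c;q)_\infty=\prod_{j\ge0}(1-cq^j)$, $(c_1,\dots,c_r;q)_k=\prod_i(c_i;q)_k$. With $x=\cos\theta$, $z=e^{i\theta}$: $\varphi_k(x;a)=(az,a/z;q)_k$ and $\widetilde{\mathcal B}^{\,n}_k(x;a,b)=\binom nk\varphi_k(x;a)\varphi_{n-k}(x;b)$. The Askey–Wilson polynomials are $$p_m(x;a,b,c,d\,|\,q)=a^{-m}(ab,ac,ad;q)_m\sum_{j=0}^{m}\frac{(q^{-m},abcd\,q^{m-1},az,a/z;q)_j}{(q,ab,ac,ad;q)_j}\,q^j .$$ The weight is $$w(x;a,b,c,d)=\frac{(z^2,z^{-2};q)_\infty}{(az,a/z,bz,b/z,cz,c/z,dz,d/z;q)_\infty},$$ the bilinear functional is $\langle f,g\rangle_{a,b,c,d}=\frac1{2\pi}\int_0^\pi f(\cos\theta)\,g(\cos\theta)\,w(\cos\theta;a,b,c,d)\,d\theta$, for which the Askey–Wilson polynomials satisfy $\langle p_m,p_{m'}\rangle_{a,b,c,d}=h_m\delta_{mm'}$ with $h_m=\langle p_m,p_m\rangle_{a,b,c,d}$ (classical fact). *)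

(* Defs.v *)
From Stdlib Require Import Reals List.
From Coquelicot Require Import Coquelicot.
Import ListNotations.

Local Open Scope C_scope.

(** ** q-shifted factorials *)

Fixpoint qpoch (c : C) (q : R) (k : nat) : C :=
  match k with
  | O => 1
  | S j => qpoch c q j * (1 - c * RtoC q ^ j)
  end.

(* [iota] picks the unique [l] satisfying the predicate; the limit exists
   whenever |q| < 1. *)
Definition qpoch_inf (c : C) (q : R) : C :=
  iota (T := C_CompleteNormedModule)
    (fun l : C => filterlim (qpoch c q) eventually (locally l)).

Definition Cprod (l : list C) : C := fold_right Cmult 1 l.

Definition qpochs (cs : list C) (q : R) (k : nat) : C :=
  Cprod (map (fun c => qpoch c q k) cs).

Definition qpochs_inf (cs : list C) (q : R) : C :=
  Cprod (map (fun c => qpoch_inf c q) cs).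

(** ** Functions of x = cos θ *)

(* z = e^{iθ} for x = cos θ, with θ = arccos x in [0, π]. All functions of x
   below are meant for -1 <= x <= 1; they are invariant under z <-> 1/z, so
   the choice of θ is immaterial. *)
Definition zof (x : R) : C := (cos (acos x), sin (acos x)).

Definition phi (q : R) (k : nat) (a : C) (x : R) : C :=
  let z := zof x in qpochs [a * z; a / z] q k.

(* [Binomial.C n k] is the ordinary binomial coefficient when k <= n. *)
Definition bernstein (q : R) (n k : nat) (a b : C) (x : R) : C :=
  RtoC (Binomial.C n k) * phi q k a x * phi q (n - k) b x.

(* Here q^{m-1} is written q^m / q, so that it is right for m = 0 as well. *)
Definition askey_wilson (q : R) (m : nat) (a b c d : C) (x : R) : C :=
  let z := zof x in
  / a ^ m * qpochs [a * b; a * c; a * d] q m *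
  sum_n (fun j =>
    qpochs [/ RtoC q ^ m; a * b * c * d * (RtoC q ^ m / RtoC q); a * z; a / z] q j
    / qpochs [RtoC q; a * b; a * c; a * d] q j
    * RtoC q ^ j) m.

Definition weight (q : R) (a b c d : C) (x : R) : C :=
  let z := zof x in
  qpochs_inf [z ^ 2; / z ^ 2] q
  / qpochs_inf [a * z; a / z; b * z; b / z; c * z; c / z; d * z; d / z] q.

(** ** The bilinear functional and the associated quantities *)

Definition weight_integral (q : R) (a b c d : C) (f : R -> C) : C :=
  / RtoC (2 * PI) *
  RInt (V := C_R_CompleteNormedModule)
    (fun theta : R => f (cos theta) * weight q a b c d (cos theta)) 0 PI.

Definition bilin (q : R) (a b c d : C) (f g : R -> C) : C :=
  weight_integral q a b c d (fun x => f x * g x).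

Definition hnorm (q : R) (a b c d : C) (m : nat) : C :=
  bilin q a b c d (askey_wilson q m a b c d) (askey_wilson q m a b c d).

Definition Jint (q : R) (a b c d : C) (n m k : nat) : C :=
  weight_integral q (a * RtoC q ^ k) (b * RtoC q ^ (n - k)) c d
    (askey_wilson q m a b c d).

Definition is_bernstein_expansion (q : R) (a b c d : C) (n k : nat)
    (Cm : nat -> C) : Prop :=
  forall x : R, (-1 <= x <= 1)%R ->
    bernstein q n k a b x
    = sum_n (fun m => Cm m * askey_wilson q m a b c d x) n.

(* Main.v *)
(** Multiplying the weight by [phi_k(x;a)] replaces its parameter [a] by [a q^k], which gives the
    moment formula; the rest is orthogonality and non-degeneracy of the pairing.

    Orthogonality comes from the total mass [I(a,b,c,d)] of the weight. The function
    [z (z^2, q/z^2)_oo / prod (az, qa/z)_oo] has the same mean on the circles of radius 1 and [q],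
    being a uniform limit of Laurent polynomials on the annulus; the difference of the two
    integrands is the weight times a linear function of [x], and this first moment yields
    [(1-abcd) I(aq,b,c,d) = (1-ab)(1-ac)(1-ad) I(a,b,c,d)]. Iterating it, [I] never vanishes, because
    for small parameters the weight has positive real part. The pairings [<p_m, phi_l(.;b)>] are then
    [I(a,b q^l,c,d)] times a terminating balanced 3phi2, which is a q-difference of order [m] of a
    polynomial of degree [m-1] in [q^j] when [l < m], and is evaluated in closed form when
    [l = m]. *)

Require Import Defs.
From Stdlib Require Import Reals Lra Lia List.
From Coquelicot Require Import Coquelicot.
Import ListNotations.
Local Open Scope C_scope.

(** * q-shifted factorials *)

(** With complex parameters the weight is in general not real and the pairing is bilinear, not
    Hermitian, so positivity yields neither a nonzero mass nor a nonzero [h_m]. Both come from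
    product formulas; positivity is used only once the parameters have been shifted close to 0. The
    weight cannot itself be carried from the unit circle to the circle of radius q: it has poles at
    the points a q^j. The kernel leaves out the factor responsible for the pole at z = a, the only
    one that can lie in the annulus, and likewise for b, c, d. The inner radius q is dictated by the
    products: z -> qz changes each of them by a single factor, so both boundary values are rational
    multiples of the same weight. Approximability by Laurent polynomials replaces holomorphy,
    because the mean of a power of z over a circle does not depend on the radius. Expanding p_m in
    phi_j(.;a) but testing against phi_l(.;b) makes every product a shifted weight again, so each
    pairing reduces to total masses. *)

Ltac C_eq := cbv beta; match goal with |- ?x = ?y => change (@eq C x y) end.

Lemma Cmod_le_minus (x y : C) : (Cmod x <= Cmod y + Cmod (x - y))%R.
Proof.
  replace x with (y + (x - y)) at 1 by ring. apply Cmod_triangle.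
Qed.

Lemma Cmod_minus_sym (x y : C) : Cmod (x - y) = Cmod (y - x).
Proof. rewrite <- Cmod_opp. f_equal. ring. Qed.

Lemma Cmod_lt_1_nz (c : C) : (Cmod c < 1)%R -> 1 - c <> 0.
Proof.
  intros h e. assert (c = 1) as -> by (rewrite <- (Cplus_0_r c), <- e; ring).
  rewrite Cmod_1 in h. lra.
Qed.

Lemma Cmod_near_1_nz (c : C) : (Cmod (c - 1) < 1)%R -> c <> 0.
Proof.
  intros h ->. replace (0 - 1) with (- (1)) in h by ring.
  rewrite Cmod_opp, Cmod_1 in h. lra.
Qed.

(** Bounds of the form u - 1 multiply, since |xy - 1| <= |x - 1||y| + |y - 1| and |y| <= v. They can
    be chained along a product: with exponentials for a q-shifted factorial, with 21/20 for the
    denominators of the weight. *)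
Lemma Cmod_mult_minus_1 (x y : C) (u v : R) :
  (Cmod (x - 1) <= u - 1 -> Cmod (y - 1) <= v - 1 ->
   Cmod (x * y - 1) <= u * v - 1)%R.
Proof.
  intros hx hy.
  replace (x * y - 1) with ((x - 1) * y + (y - 1)) by ring.
  eapply Rle_trans; [apply Cmod_triangle|]. rewrite Cmod_mult.
  assert (Cmod y <= v)%R.
  { generalize (Cmod_le_minus y 1). rewrite Cmod_1. lra. }
  generalize (Cmod_ge_0 (x - 1)) (Cmod_ge_0 y); intros.
  assert (Cmod (x - 1) * Cmod y <= (u - 1) * v)%R by (apply Rmult_le_compat; lra).
  lra.
Qed.

Lemma exp_le (x y : R) : (x <= y -> exp x <= exp y)%R.
Proof.
  intros [h| ->]; [left; now apply exp_increasing|right; reflexivity].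
Qed.

Section QPochhammer.

Context (q : R) (hq : (0 < q < 1)%R).

Lemma q_nz : RtoC q <> 0.
Proof. intros h. apply RtoC_inj in h. lra. Qed.

Lemma Cmod_mult_qpow (c : C) (n : nat) : Cmod (c * RtoC q ^ n) = (Cmod c * q ^ n)%R.
Proof. rewrite Cmod_mult, <- RtoC_pow, Cmod_R, Rabs_pos_eq; auto. apply pow_le; lra. Qed.

Lemma qpow_le_1 (n : nat) : (0 < q ^ n <= 1)%R.
Proof.
  split; [apply pow_lt; lra|]. rewrite <- (pow1 n). apply pow_incr; lra.
Qed.

Lemma Cmod_mult_qpow_lt_1 (c : C) (n : nat) :
  (Cmod c < 1)%R -> (Cmod (c * RtoC q ^ n) < 1)%R.
Proof.
  intros h. rewrite Cmod_mult_qpow. generalize (qpow_le_1 n) (Cmod_ge_0 c). nra.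
Qed.

Lemma qpoch_add (c : C) (N M : nat) :
  qpoch c q (N + M) = qpoch c q N * qpoch (c * RtoC q ^ N) q M.
Proof.
  induction M; simpl.
  - rewrite Nat.add_0_r. ring.
  - rewrite Nat.add_succ_r. simpl. rewrite IHM, Cpow_add_r. ring.
Qed.

Lemma qpoch_S_l (c : C) (N : nat) :
  qpoch c q (S N) = (1 - c) * qpoch (c * RtoC q) q N.
Proof.
  generalize (qpoch_add c 1 N). simpl. intros ->.
  replace (1 * (1 - c * 1)) with (1 - c) by ring.
  replace (c * (RtoC q * 1)) with (c * RtoC q) by ring. reflexivity.
Qed.

Lemma qpoch_nz (c : C) (N : nat) :
  (forall j, (j < N)%nat -> 1 - c * RtoC q ^ j <> 0) -> qpoch c q N <> 0.
Proof.
  induction N; simpl; intros h.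
  - apply C1_nz.
  - apply Cmult_neq_0; auto.
Qed.

Lemma qpoch_nz_lt_1 (c : C) (N : nat) : (Cmod c < 1)%R -> qpoch c q N <> 0.
Proof.
  intros h. apply qpoch_nz. intros j _. apply Cmod_lt_1_nz, Cmod_mult_qpow_lt_1, h.
Qed.

Lemma qpoch_conj (c : C) (N : nat) : Cconj (qpoch c q N) = qpoch (Cconj c) q N.
Proof.
  induction N; simpl.
  - unfold Cconj; simpl. apply injective_projections; simpl; ring.
  - rewrite Cmult_conj, IHN, Cminus_conj, Cmult_conj, Cpow_conj.
    f_equal. f_equal; [|f_equal; f_equal]; apply injective_projections; simpl; ring.
Qed.

Let geo := (/ (1 - q))%R.

Lemma geo_pos : (0 < geo)%R.
Proof. apply Rinv_0_lt_compat. lra. Qed.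

(* The exponent is the partial sum of the geometric series. *)
Lemma qpoch_minus_1_le_partial (c : C) (N : nat) :
  (Cmod (qpoch c q N - 1) <= exp (Cmod c * ((1 - q ^ N) * geo)) - 1)%R.
Proof.
  induction N; simpl.
  - replace (1 - 1) with (RtoC 0) by ring. rewrite Cmod_0.
    replace (Cmod c * ((1 - 1) * geo))%R with 0%R by ring. rewrite exp_0. lra.
  - replace (Cmod c * ((1 - q * q ^ N) * geo))%R
      with (Cmod c * ((1 - q ^ N) * geo) + Cmod c * q ^ N)%R
      by (unfold geo; field; lra).
    rewrite exp_plus. apply Cmod_mult_minus_1; [exact IHN|].
    replace (1 - c * RtoC q ^ N - 1) with (- (c * RtoC q ^ N)) by ring.
    rewrite Cmod_opp, Cmod_mult_qpow.
    generalize (exp_ineq1_le (Cmod c * q ^ N)). lra.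
Qed.

Lemma qpoch_minus_1_le (c : C) (N : nat) :
  (Cmod (qpoch c q N - 1) <= exp (Cmod c * geo) - 1)%R.
Proof.
  eapply Rle_trans; [apply qpoch_minus_1_le_partial|].
  apply Rplus_le_compat_r, exp_le.
  apply Rmult_le_compat_l; [apply Cmod_ge_0|].
  generalize geo_pos (qpow_le_1 N). nra.
Qed.

Lemma qpoch_le (c : C) (N : nat) : (Cmod (qpoch c q N) <= exp (Cmod c * geo))%R.
Proof.
  generalize (qpoch_minus_1_le c N) (Cmod_le_minus (qpoch c q N) 1).
  rewrite Cmod_1. lra.
Qed.

(** Bounds (c;q)_(N+M) - (c;q)_N for |c| = r: the first N factors contribute at most exp(r/(1-q)),
    and the product of the others differs from 1 by at most exp(r q^N/(1-q)) - 1. *)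
Definition qpoch_tail (r : R) (N : nat) : R :=
  (exp (r * geo) * (exp (r * q ^ N * geo) - 1))%R.

Lemma qpoch_tail_lim (r eps : R) : (0 < eps)%R ->
  exists N0, forall N, (N0 <= N)%nat -> (qpoch_tail r N < eps)%R.
Proof.
  intros heps.
  assert (L : is_lim_seq (qpoch_tail r) 0%R).
  { unfold qpoch_tail.
    replace (Finite 0) with (Finite (exp (r * geo) * (exp (r * 0 * geo) - 1))%R)
      by (f_equal; rewrite Rmult_0_r, Rmult_0_l, exp_0; ring).
    apply (is_lim_seq_mult' _ _ _ _ (is_lim_seq_const _)).
    apply (is_lim_seq_minus' _ _ _ _); [|apply is_lim_seq_const].
    apply (is_lim_seq_continuous exp).
    - apply derivable_continuous_pt, derivable_pt_exp.
    - apply is_lim_seq_mult'; [|apply is_lim_seq_const].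
      apply is_lim_seq_mult'; [apply is_lim_seq_const|].
      apply is_lim_seq_geom. rewrite Rabs_pos_eq; lra. }
  apply is_lim_seq_spec in L. destruct (L (mkposreal _ heps)) as [N0 h].
  exists N0. intros N hN. specialize (h N hN). simpl in h.
  rewrite Rminus_0_r in h. apply Rabs_def2 in h. lra.
Qed.

Lemma qpoch_cauchy (c : C) (N M : nat) :
  (Cmod (qpoch c q (N + M) - qpoch c q N) <= qpoch_tail (Cmod c) N)%R.
Proof.
  rewrite qpoch_add.
  match goal with |- (Cmod (?x * ?y - ?x) <= _)%R =>
    replace (x * y - x) with (x * (y - 1)) by ring end.
  rewrite Cmod_mult. apply Rmult_le_compat; try apply Cmod_ge_0.
  - apply qpoch_le.
  - rewrite <- Cmod_mult_qpow. apply qpoch_minus_1_le.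
Qed.

Lemma Cball_of_Cmod (x y : C) (eps : R) : (Cmod (y - x) < eps)%R -> ball x eps y.
Proof. exact (C_NormedModule_mixin_compat1 x y eps). Qed.

(** Balls of C are squares in the product structure, hence the factor sqrt 2 when passing to the
    modulus. *)
Lemma Cball_Cmod (x y : C) (eps : R) : ball x eps y -> (Cmod (y - x) < sqrt 2 * eps)%R.
Proof.
  intros h. assert (0 < eps)%R as he.
  { destruct h as [h _]. unfold ball in h. simpl in h. unfold AbsRing_ball in h.
    exact (Rle_lt_trans _ _ _ (Rabs_pos _) h). }
  exact (C_NormedModule_mixin_compat2 x y (mkposreal eps he) h).
Qed.

Lemma sqrt2_pos : (0 < sqrt 2)%R.
Proof. apply sqrt_lt_R0. lra. Qed.

Lemma filterlim_C_eps (u : nat -> C) (l : C) :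
  filterlim u eventually (locally l) <->
  (forall eps, (0 < eps)%R -> exists N0, forall N, (N0 <= N)%nat -> (Cmod (u N - l) < eps)%R).
Proof.
  split.
  - intros h eps he.
    assert (he' : (0 < eps / sqrt 2)%R) by (apply Rdiv_lt_0_compat; [lra|apply sqrt2_pos]).
    destruct (proj1 (filterlim_locally _ _) h (mkposreal _ he')) as [N0 h0].
    exists N0. intros N hN. specialize (h0 N hN). apply Cball_Cmod in h0. simpl in h0.
    replace (sqrt 2 * (eps / sqrt 2))%R with eps in h0
      by (field; generalize sqrt2_pos; lra). exact h0.
  - intros h. apply filterlim_locally. intros eps.
    destruct (h eps (cond_pos eps)) as [N0 h0]. exists N0. intros N hN.
    apply Cball_of_Cmod, h0, hN.
Qed.

Lemma qpoch_has_limit (c : C) :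
  exists l : C, filterlim (qpoch c q) eventually (locally l).
Proof.
  apply (Hierarchy.filterlim_locally_cauchy (U := C_CompleteNormedModule)).
  intros eps. assert (he : (0 < eps / 2)%R) by (generalize (cond_pos eps); lra).
  destruct (qpoch_tail_lim (Cmod c) _ he) as [N0 h0].
  exists (fun n => (N0 <= n)%nat). split; [exists N0; auto|].
  intros n m hn hm. apply Cball_of_Cmod.
  generalize (qpoch_cauchy c N0 (n - N0)) (qpoch_cauchy c N0 (m - N0)) (h0 N0 (le_n _)).
  replace (N0 + (n - N0))%nat with n by lia. replace (N0 + (m - N0))%nat with m by lia.
  intros h1 h2 h3.
  replace (qpoch c q m - qpoch c q n)
    with ((qpoch c q m - qpoch c q N0) + (qpoch c q N0 - qpoch c q n)) by ring.
  eapply Rle_lt_trans; [apply Cmod_triangle|].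
  rewrite (Cmod_minus_sym (qpoch c q N0)). lra.
Qed.

Lemma qpoch_inf_unique (c l : C) :
  (forall eps, (0 < eps)%R ->
     exists N0, forall N, (N0 <= N)%nat -> (Cmod (qpoch c q N - l) < eps)%R) ->
  qpoch_inf c q = l.
Proof.
  intros h. unfold qpoch_inf.
  apply (iota_filterlim_locally (V := C_CompleteNormedModule) (F := eventually)).
  now apply filterlim_C_eps.
Qed.

Lemma qpoch_inf_lim (c : C) (eps : R) : (0 < eps)%R ->
  exists N0, forall N, (N0 <= N)%nat -> (Cmod (qpoch c q N - qpoch_inf c q) < eps)%R.
Proof.
  destruct (qpoch_has_limit c) as [l hl].
  assert (qpoch_inf c q = l) as ->
    by (apply qpoch_inf_unique; now apply filterlim_C_eps).
  revert eps. now apply filterlim_C_eps.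
Qed.

Lemma qpoch_inf_shift (c : C) (N : nat) :
  qpoch_inf c q = qpoch c q N * qpoch_inf (c * RtoC q ^ N) q.
Proof.
  apply qpoch_inf_unique. intros eps he.
  (* The added 1 keeps [B] positive when the finite product vanishes. *)
  set (p := qpoch c q N). set (B := (Cmod p + 1)%R).
  assert (hB : (0 < B)%R) by (unfold B; generalize (Cmod_ge_0 p); lra).
  destruct (qpoch_inf_lim (c * RtoC q ^ N) (eps / B)) as [N0 h0];
    [now apply Rdiv_lt_0_compat|].
  exists (N + N0)%nat. intros n hn.
  replace n with (N + (n - N))%nat by lia. rewrite qpoch_add. fold p.
  match goal with |- (Cmod (?x * ?y - ?x * ?z) < _)%R =>
    replace (x * y - x * z) with (x * (y - z)) by ring end.
  rewrite Cmod_mult.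
  specialize (h0 (n - N)%nat ltac:(lia)).
  apply Rle_lt_trans with (Cmod p * (eps / B))%R.
  - apply Rmult_le_compat_l; [apply Cmod_ge_0|lra].
  - replace eps with (B * (eps / B))%R at 2 by (field; lra).
    apply Rmult_lt_compat_r; [now apply Rdiv_lt_0_compat|]. unfold B; lra.
Qed.

Lemma qpoch_inf_shift_1 (c : C) :
  qpoch_inf c q = (1 - c) * qpoch_inf (c * RtoC q) q.
Proof.
  rewrite (qpoch_inf_shift c 1). simpl.
  replace (c * (RtoC q * 1)) with (c * RtoC q) by ring. ring.
Qed.

(** The limit M -> oo in [qpoch_cauchy]. The bound depends on c only through |c|, which makes the
    convergence uniform on bounded sets. *)
Lemma qpoch_inf_tail (c : C) (N : nat) :
  (Cmod (qpoch c q N - qpoch_inf c q) <= qpoch_tail (Cmod c) N)%R.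
Proof.
  apply Rnot_lt_le. intros h.
  set (e := (Cmod (qpoch c q N - qpoch_inf c q) - qpoch_tail (Cmod c) N)%R).
  destruct (qpoch_inf_lim c e) as [N0 h0]; [unfold e; lra|].
  specialize (h0 (N + N0)%nat ltac:(lia)).
  generalize (qpoch_cauchy c N N0); intros h1.
  assert (h2 : (Cmod (qpoch c q N - qpoch_inf c q) <=
    Cmod (qpoch c q N - qpoch c q (N + N0)) + Cmod (qpoch c q (N + N0) - qpoch_inf c q))%R).
  { eapply Rle_trans; [|apply Cmod_triangle]. right. f_equal. ring. }
  rewrite (Cmod_minus_sym (qpoch c q N) (qpoch c q (N + N0))) in h2. unfold e in h0. lra.
Qed.

Lemma qpoch_inf_minus_1_le (c : C) :
  (Cmod (qpoch_inf c q - 1) <= exp (Cmod c * geo) - 1)%R.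
Proof.
  generalize (qpoch_inf_tail c 0). unfold qpoch_tail. simpl.
  rewrite Rmult_1_r, Cmod_minus_sym. intros h.
  apply Rnot_lt_le. intros h'.
  destruct (qpoch_inf_lim c (Cmod (qpoch_inf c q - 1) - (exp (Cmod c * geo) - 1))) as [N0 h0];
    [lra|].
  specialize (h0 N0 (le_n _)). rewrite Cmod_minus_sym in h0.
  generalize (qpoch_minus_1_le c N0). intros h1.
  assert (Cmod (qpoch_inf c q - 1) <=
    Cmod (qpoch_inf c q - qpoch c q N0) + Cmod (qpoch c q N0 - 1))%R; [|lra].
  eapply Rle_trans; [|apply Cmod_triangle]. right. f_equal. ring.
Qed.

(** One [N] serves the whole disc |c| <= r, so it can be used uniformly in z and for all denominator
    factors of the weight at once. *)
Lemma qpoch_inf_near_1 (r eps : R) : (0 <= r)%R -> (0 < eps)%R ->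
  exists N, forall c, (Cmod c <= r)%R ->
    (Cmod (qpoch_inf (c * RtoC q ^ N) q - 1) <= eps)%R.
Proof.
  intros hr he.
  destruct (qpoch_tail_lim r eps he) as [N h]. exists N. intros c hc.
  specialize (h N (le_n _)). eapply Rle_trans; [apply qpoch_inf_minus_1_le|].
  rewrite Cmod_mult_qpow. apply Rle_trans with (exp (r * q ^ N * geo) - 1)%R.
  - apply Rplus_le_compat_r, exp_le. apply Rmult_le_compat_r; [left; apply geo_pos|].
    apply Rmult_le_compat_r; [left; apply qpow_le_1|exact hc].
  (* The first exponential in [qpoch_tail] is at least 1, so dropping it only lowers the bound. *)
  - left. eapply Rle_lt_trans; [|exact h]. unfold qpoch_tail.
    rewrite <- (Rmult_1_l (_ - 1)) at 1. apply Rmult_le_compat_r.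
    + generalize (exp_ineq1_le (r * q ^ N * geo)).
      assert (0 <= r * q ^ N * geo)%R; [|lra].
      generalize geo_pos (qpow_le_1 N). intros. apply Rmult_le_pos; [nra|lra].
    + rewrite <- exp_0. apply exp_le. generalize geo_pos. intros. nra.
Qed.

(** A far enough tail is within 1/2 of 1, so the product can vanish only through one of finitely
    many leading factors. *)
Lemma qpoch_inf_nz (c : C) :
  (forall j, 1 - c * RtoC q ^ j <> 0) -> qpoch_inf c q <> 0.
Proof.
  intros h.
  destruct (qpoch_inf_near_1 (Cmod c) (1/2) (Cmod_ge_0 c) ltac:(lra)) as [N hN].
  rewrite (qpoch_inf_shift c N). apply Cmult_neq_0.
  - apply qpoch_nz; auto.
  - apply Cmod_near_1_nz. specialize (hN c (Rle_refl _)). lra.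
Qed.

Lemma qpoch_inf_nz_lt_1 (c : C) : (Cmod c < 1)%R -> qpoch_inf c q <> 0.
Proof.
  intros h. apply qpoch_inf_nz. intros j. apply Cmod_lt_1_nz, Cmod_mult_qpow_lt_1, h.
Qed.

(** On the unit circle this makes the numerator (z^2, z^-2;q)_oo of the weight a squared modulus. *)
Lemma qpoch_inf_conj (c : C) : qpoch_inf (Cconj c) q = Cconj (qpoch_inf c q).
Proof.
  apply qpoch_inf_unique. intros eps he.
  destruct (qpoch_inf_lim c eps he) as [N0 h0]. exists N0. intros N hN.
  rewrite <- qpoch_conj, <- Cminus_conj, Cmod_conj. auto.
Qed.

End QPochhammer.

(** * Uniform limits of Laurent polynomials on circles *)

Definition cis (t : R) : C := (cos t, sin t).

Lemma Cmod_cis (t : R) : Cmod (cis t) = 1%R.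
Proof.
  unfold Cmod, cis; simpl. rewrite !Rmult_1_r, Rplus_comm.
  generalize (sin2_cos2 t). unfold Rsqr. intros ->. apply sqrt_1.
Qed.

Lemma cis_nz (t : R) : cis t <> 0.
Proof. intros h. generalize (Cmod_cis t). rewrite h, Cmod_0. lra. Qed.

Lemma cis_add (s t : R) : cis (s + t) = cis s * cis t.
Proof.
  unfold cis, Cmult; simpl. rewrite cos_plus, sin_plus. f_equal; ring.
Qed.

Lemma cis_0 : cis 0 = 1.
Proof. unfold cis. rewrite cos_0, sin_0. reflexivity. Qed.

Lemma cis_inv (t : R) : / cis t = cis (- t).
Proof.
  assert (h : cis (- t) * cis t = 1).
  { rewrite <- cis_add, Rplus_opp_l. apply cis_0. }
  rewrite <- (Cmult_1_l (/ cis t)), <- h. field. apply cis_nz.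
Qed.

Lemma cis_conj (t : R) : Cconj (cis t) = cis (- t).
Proof. unfold Cconj, cis; simpl. now rewrite cos_neg, sin_neg. Qed.

Lemma cis_pow (t : R) (n : nat) : cis t ^ n = cis (INR n * t).
Proof.
  induction n.
  - simpl. rewrite Rmult_0_l, cis_0. reflexivity.
  - rewrite Cpow_S, IHn, S_INR, <- cis_add. f_equal. ring.
Qed.

(** * Integrals of complex-valued functions and of monomials on circles *)

Notation is_CRInt := (is_RInt (V := C_R_NormedModule)).

(** The integral lives in a real normed module, so the product with a complex constant is expanded
    into real and imaginary parts. *)
Lemma is_CRInt_mult (f : R -> C) (a b : R) (c l : C) :
  is_CRInt f a b l -> is_CRInt (fun t => c * f t) a b (c * l).
Proof.
  intros h.
  pose proof (is_RInt_fct_extend_fst _ _ _ _ h) as h1.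
  pose proof (is_RInt_fct_extend_snd _ _ _ _ h) as h2.
  destruct c as [x y]. apply (is_RInt_fct_extend_pair (U := R_NormedModule) (V := R_NormedModule)); simpl.
  - apply (is_RInt_minus (V := R_NormedModule) (fun t => x * fst (f t))%R (fun t => y * snd (f t))%R).
    + apply (is_RInt_scal (V := R_NormedModule)), h1.
    + apply (is_RInt_scal (V := R_NormedModule)), h2.
  - apply (is_RInt_plus (V := R_NormedModule) (fun t => x * snd (f t))%R (fun t => y * fst (f t))%R).
    + apply (is_RInt_scal (V := R_NormedModule)), h2.
    + apply (is_RInt_scal (V := R_NormedModule)), h1.
Qed.

Lemma CR_norm_Cmod (x : C) : norm (V := C_R_NormedModule) x = Cmod x.
Proof.
  unfold norm; simpl. unfold prod_norm, Cmod, norm; simpl. unfold abs; simpl.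
  f_equal. rewrite !Rmult_1_r, <- !Rabs_mult.
  rewrite !Rabs_pos_eq by nra. reflexivity.
Qed.

Lemma is_CRInt_le (f : R -> C) (a b M : R) (l : C) : (a <= b)%R ->
  (forall t, (a <= t <= b)%R -> (Cmod (f t) <= M)%R) ->
  is_CRInt f a b l -> (Cmod l <= (b - a) * M)%R.
Proof.
  intros hab h hl. rewrite <- CR_norm_Cmod.
  apply (norm_RInt_le_const f a b l M hab); [|exact hl].
  intros t ht. rewrite CR_norm_Cmod. auto.
Qed.

Lemma is_RInt_cos_sin_period (i j : nat) : i <> j ->
  is_RInt (fun t => cos ((INR i - INR j) * t)) (- PI) PI 0%R /\
  is_RInt (fun t => sin ((INR i - INR j) * t)) (- PI) PI 0%R.
Proof.
  intros hij. set (k := (INR i - INR j)%R).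
  assert (hk : k <> 0%R).
  { unfold k. intros h. apply hij, INR_eq. lra. }
  assert (hs : sin (k * PI) = 0%R).
  { apply sin_eq_0_1. exists (Z.of_nat i - Z.of_nat j)%Z.
    unfold k. now rewrite minus_IZR, <- !INR_IZR_INZ. }
  split.
  - replace 0%R with (minus (sin (k * PI) / k) (sin (k * - PI) / k))%R.
    + apply (is_RInt_derive (fun t => sin (k * t) / k)%R); intros t _.
      * auto_derive; [easy|]. now field.
      * apply continuous_comp; [|apply continuous_cos].
        apply (continuous_scal_r (V := R_NormedModule) k (fun t => t)), continuous_id.
    + unfold minus, plus, opp; simpl.
      replace (k * - PI)%R with (- (k * PI))%R by ring. rewrite sin_neg, hs. field. easy.
  - replace 0%R with (minus (- cos (k * PI) / k) (- cos (k * - PI) / k))%R.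
    + apply (is_RInt_derive (fun t => - cos (k * t) / k)%R); intros t _.
      * auto_derive; [easy|]. now field.
      * apply continuous_comp; [|apply continuous_sin].
        apply (continuous_scal_r (V := R_NormedModule) k (fun t => t)), continuous_id.
    + unfold minus, plus, opp; simpl.
      replace (k * - PI)%R with (- (k * PI))%R by ring. rewrite cos_neg. field. easy.
Qed.

(** The value [l] is chosen before the radius: for i = j the powers of r cancel, for i <> j the
    integral of cis((i - j) t) over the full period is zero. The pair i, j encodes the integer
    exponent i - j. *)
Lemma is_CRInt_monomial (i j : nat) : exists l, forall r : R, (0 < r)%R ->
  is_CRInt (fun t => (RtoC r * cis t) ^ i * / (RtoC r * cis t) ^ j) (- PI) PI l.
Proof.
  exists (if Nat.eq_dec i j then RtoC (2 * PI) else 0). intros r hr.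
  assert (hr0 : RtoC r <> 0) by (intros h; apply RtoC_inj in h; lra).
  apply (is_RInt_ext (V := C_R_NormedModule)
    (fun t => RtoC (r ^ i / r ^ j) * cis ((INR i - INR j) * t))).
  { intros t _. C_eq. rewrite !Cpow_mult_l, !cis_pow.
    assert (hrj : (r ^ j <> 0)%R) by (apply pow_nonzero; lra).
    assert (hcj := Cpow_nz _ j hr0).
    rewrite RtoC_div, !RtoC_pow by exact hrj.
    replace ((INR i - INR j) * t)%R with (INR i * t + - (INR j * t))%R by ring.
    rewrite cis_add, <- cis_inv. field. split; [apply cis_nz|exact hcj]. }
  destruct (Nat.eq_dec i j) as [<-|hij].
  - replace (RtoC (2 * PI)) with (RtoC (r ^ i / r ^ i) * RtoC (2 * PI)).
    + apply is_CRInt_mult.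
      apply (is_RInt_ext (V := C_R_NormedModule) (fun _ => RtoC 1)).
      * intros t _. C_eq. rewrite Rminus_diag, Rmult_0_l, cis_0. reflexivity.
      * replace (RtoC (2 * PI)) with (scal (V := C_R_NormedModule) (PI - - PI)%R (RtoC 1)).
        -- apply (is_RInt_const (V := C_R_NormedModule)).
        -- apply injective_projections; cbn; unfold mult; cbn; ring.
    + rewrite <- RtoC_mult. f_equal. field. apply pow_nonzero; lra.
  - replace (RtoC 0) with (RtoC (r ^ i / r ^ j) * RtoC 0) by ring.
    apply is_CRInt_mult. destruct (is_RInt_cos_sin_period i j hij) as [h1 h2].
    apply (is_RInt_fct_extend_pair (U := R_NormedModule) (V := R_NormedModule)); assumption.
Qed.

(** Generated by single multiplications by z and 1/z, so that inductions move one power at a time;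
    [laurent_ext] closes the predicate under pointwise equality. *)
Inductive laurent : (C -> C) -> Prop :=
| laurent_ext f g : (forall z, f z = g z) -> laurent f -> laurent g
| laurent_const c : laurent (fun _ => c)
| laurent_plus f g : laurent f -> laurent g -> laurent (fun z => f z + g z)
| laurent_mult_z f : laurent f -> laurent (fun z => z * f z)
| laurent_mult_inv f : laurent f -> laurent (fun z => / z * f z).

Lemma laurent_mult (f g : C -> C) :
  laurent f -> laurent g -> laurent (fun z => f z * g z).
Proof.
  intros hf hg. induction hf.
  - apply (laurent_ext (fun z => f z * g z)); [|assumption].
    intros z. now rewrite H.
  - induction hg.
    + apply (laurent_ext (fun z => c * f z)); [|assumption]. intros z. now rewrite H.
    + apply laurent_const.
    + apply (laurent_ext (fun z => c * f z + c * g z)); [intros; ring|].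
      now apply laurent_plus.
    + apply (laurent_ext (fun z => z * (c * f z))); [intros; ring|].
      now apply laurent_mult_z.
    + apply (laurent_ext (fun z => / z * (c * f z))); [intros; ring|].
      now apply laurent_mult_inv.
  - apply (laurent_ext (fun z => f z * g z + g0 z * g z)); [intros; ring|].
    now apply laurent_plus.
  - apply (laurent_ext (fun z => z * (f z * g z))); [intros; ring|].
    now apply laurent_mult_z.
  - apply (laurent_ext (fun z => / z * (f z * g z))); [intros; ring|].
    now apply laurent_mult_inv.
Qed.

(* The monomial factor makes the induction go through multiplication by [z] and [1/z]. *)
Lemma laurent_mean (f : C -> C) : laurent f -> forall i j, exists l, forall r : R, (0 < r)%R ->
  is_CRInt (fun t => (RtoC r * cis t) ^ i * / (RtoC r * cis t) ^ j * f (RtoC r * cis t))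
    (- PI) PI l.
Proof.
  intros hf. induction hf; intros i j.
  - destruct (IHhf i j) as [l h]. exists l. intros r hr.
    eapply (is_RInt_ext (V := C_R_NormedModule)); [|exact (h r hr)].
    intros t _. C_eq. simpl. now rewrite H.
  - destruct (is_CRInt_monomial i j) as [l h]. exists (c * l). intros r hr.
    eapply (is_RInt_ext (V := C_R_NormedModule)); [|exact (is_CRInt_mult _ _ _ c _ (h r hr))].
    intros t _. C_eq. simpl. ring.
  - destruct (IHhf1 i j) as [l1 h1]. destruct (IHhf2 i j) as [l2 h2].
    exists (l1 + l2). intros r hr.
    eapply (is_RInt_ext (V := C_R_NormedModule));
      [|exact (is_RInt_plus (V := C_R_NormedModule) _ _ _ _ _ _ (h1 r hr) (h2 r hr))].
    intros t _. C_eq.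
    match goal with |- plus ?x ?y = _ => change (plus x y) with (x + y) end. ring.
  - destruct (IHhf (S i) j) as [l h]. exists l. intros r hr.
    eapply (is_RInt_ext (V := C_R_NormedModule)); [|exact (h r hr)].
    intros t _. C_eq. rewrite Cpow_S. simpl. ring.
  - destruct (IHhf i (S j)) as [l h]. exists l. intros r hr.
    eapply (is_RInt_ext (V := C_R_NormedModule)); [|exact (h r hr)].
    intros t _. C_eq. rewrite Cpow_S. simpl.
    assert (hr0 : RtoC r <> 0) by (intros e; apply RtoC_inj in e; lra).
    field. repeat split; auto using cis_nz, Cpow_nz, Cmult_neq_0.
Qed.

(** Stated by components, which reduces products to real continuity and gives the continuity of the
    real part directly. *)
Definition Ccontinuous (f : R -> C) (t : R) : Prop :=
  continuous (fun s => fst (f s)) t /\ continuous (fun s => snd (f s)) t.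

Lemma Ccontinuous_ext (f g : R -> C) (t : R) :
  (forall s, f s = g s) -> Ccontinuous f t -> Ccontinuous g t.
Proof.
  intros h [h1 h2]; split.
  - eapply continuous_ext; [|exact h1]. intros s. simpl. now rewrite h.
  - eapply continuous_ext; [|exact h2]. intros s. simpl. now rewrite h.
Qed.

Lemma Ccontinuous_const (c : C) (t : R) : Ccontinuous (fun _ => c) t.
Proof. split; apply continuous_const. Qed.

Lemma Ccontinuous_cis (t : R) : Ccontinuous cis t.
Proof. split; [apply continuous_cos|apply continuous_sin]. Qed.

Lemma Ccontinuous_cis_opp (t : R) : Ccontinuous (fun s => cis (- s)) t.
Proof.
  split; [apply (continuous_comp Ropp cos)|apply (continuous_comp Ropp sin)];
    try apply continuous_cos; try apply continuous_sin;
    apply (continuous_opp (V := R_NormedModule) (fun s => s)), continuous_id.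
Qed.

Lemma Ccontinuous_plus (f g : R -> C) (t : R) :
  Ccontinuous f t -> Ccontinuous g t -> Ccontinuous (fun s => f s + g s) t.
Proof.
  intros [h1 h2] [h3 h4].
  split; apply (continuous_plus (V := R_NormedModule)); assumption.
Qed.

Lemma Ccontinuous_mult (f g : R -> C) (t : R) :
  Ccontinuous f t -> Ccontinuous g t -> Ccontinuous (fun s => f s * g s) t.
Proof.
  intros [h1 h2] [h3 h4]. split.
  - apply (continuous_minus (V := R_NormedModule)); apply (continuous_mult (K := R_AbsRing)); assumption.
  - apply (continuous_plus (V := R_NormedModule)); apply (continuous_mult (K := R_AbsRing)); assumption.
Qed.

Lemma Ccontinuous_continuous (f : R -> C) (t : R) :
  Ccontinuous f t -> continuous (U := C_R_NormedModule) f t.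
Proof.
  intros [h1 h2]. apply filterlim_locally. intros eps.
  generalize (proj1 (filterlim_locally _ _) h1 eps) (proj1 (filterlim_locally _ _) h2 eps).
  intros e1 e2. generalize (filter_and _ _ e1 e2). apply filter_imp.
  intros s [a1 a2]. split; assumption.
Qed.

Lemma snd_le_Cmod (c : C) : (Rabs (snd c) <= Cmod c)%R.
Proof. eapply Rle_trans; [apply Rmax_r|apply Rmax_Cmod]. Qed.

(** The eps/3 argument; the approximant may depend on eps and is continuous at the single point
    [t]. *)
Lemma continuous_R_uniform (f : R -> R) (t : R) :
  (forall eps, (0 < eps)%R -> exists g, continuous g t /\ forall s, (Rabs (f s - g s) < eps)%R) ->
  continuous f t.
Proof.
  intros h. apply filterlim_locally. intros eps.
  assert (he : (0 < eps / 3)%R) by (generalize (cond_pos eps); lra).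
  destruct (h _ he) as [g [hg hfg]].
  generalize (proj1 (filterlim_locally _ _) hg (mkposreal _ he)). apply filter_imp.
  intros s hs. unfold ball in *; simpl in *. unfold AbsRing_ball, abs, minus, plus, opp in *.
  simpl in *. generalize (hfg s) (hfg t). intros h1 h2.
  apply Rabs_def2 in hs, h1, h2. apply Rabs_def1; lra.
Qed.

Lemma Ccontinuous_uniform (f : R -> C) (t : R) :
  (forall eps, (0 < eps)%R -> exists g, Ccontinuous g t /\ forall s, (Cmod (f s - g s) < eps)%R) ->
  Ccontinuous f t.
Proof.
  intros h. split; apply continuous_R_uniform; intros eps he;
    destruct (h eps he) as [g [[h1 h2] hg]].
  - exists (fun s => fst (g s)). split; [exact h1|]. intros s.
    eapply Rle_lt_trans; [|exact (hg s)]. apply (re_le_Cmod (f s - g s)).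
  - exists (fun s => snd (g s)). split; [exact h2|]. intros s.
    eapply Rle_lt_trans; [|exact (hg s)]. apply (snd_le_Cmod (f s - g s)).
Qed.

Lemma laurent_continuous (f : C -> C) (r t : R) : (0 < r)%R -> laurent f ->
  Ccontinuous (fun s => f (RtoC r * cis s)) t.
Proof.
  intros hr hf.
  assert (hr0 : RtoC r <> 0) by (intros e; apply RtoC_inj in e; lra).
  induction hf.
  - eapply Ccontinuous_ext; [|exact IHhf]. intros s. simpl. apply H.
  - apply Ccontinuous_const.
  - now apply Ccontinuous_plus.
  - apply Ccontinuous_mult; [|exact IHhf].
    apply Ccontinuous_mult; [apply Ccontinuous_const|apply Ccontinuous_cis].
  - apply Ccontinuous_mult; [|exact IHhf].
    apply (Ccontinuous_ext (fun s => / RtoC r * cis (- s))).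
    + intros s. rewrite <- cis_inv. field. split; [apply cis_nz|exact hr0].
    + apply Ccontinuous_mult; [apply Ccontinuous_const|apply Ccontinuous_cis_opp].
Qed.

(** * The algebra of uniform limits of Laurent polynomials *)

Section UniformAlgebra.

Context (K : C -> Prop) (r R0 : R) (hr : (0 < r)%R)
  (hK : forall z, K z -> (r <= Cmod z <= R0)%R).

(** Stands in for holomorphy on [K]: the class is stable under sums, products, uniform limits and
    inverses near 1, and its members have equal means on circles contained in [K]. The bounds on |z|
    over [K] keep both z and 1/z bounded. *)
Definition unif_laurent (f : C -> C) : Prop :=
  forall eps, (0 < eps)%R ->
  exists g, laurent g /\ forall z, K z -> (Cmod (f z - g z) < eps)%R.

Lemma laurent_bounded (g : C -> C) : laurent g ->
  exists B, (0 < B)%R /\ forall z, K z -> (Cmod (g z) <= B)%R.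
Proof.
  intros hg. induction hg.
  - destruct IHhg as [B [hB h]]. exists B. split; [exact hB|]. intros z hz.
    rewrite <- H. auto.
  - exists (Cmod c + 1)%R. generalize (Cmod_ge_0 c). intros; split; intros; lra.
  - destruct IHhg1 as [B [hB h]], IHhg2 as [B' [hB' h']].
    exists (B + B')%R. split; [lra|]. intros z hz.
    eapply Rle_trans; [apply Cmod_triangle|]. apply Rplus_le_compat; auto.
  - destruct IHhg as [B [hB h]]. exists ((Rabs R0 + 1) * B)%R. generalize (Rabs_pos R0). intros hR.
    split; [nra|]. intros z hz. rewrite Cmod_mult.
    destruct (hK z hz). generalize (Rle_abs R0). intros.
    apply Rmult_le_compat; auto using Cmod_ge_0. lra.
  - destruct IHhg as [B [hB h]]. exists (/ r * B)%R.
    split; [apply Rmult_lt_0_compat; [now apply Rinv_0_lt_compat|exact hB]|].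
    intros z hz. destruct (hK z hz).
    rewrite Cmod_mult, Cmod_inv by (apply Cmod_gt_0; lra).
    apply Rmult_le_compat; auto using Cmod_ge_0.
    + left. apply Rinv_0_lt_compat. lra.
    + now apply Rinv_le_contravar.
Qed.

Lemma unif_bounded (f : C -> C) : unif_laurent f ->
  exists B, (0 < B)%R /\ forall z, K z -> (Cmod (f z) <= B)%R.
Proof.
  intros hf. destruct (hf 1%R Rlt_0_1) as [g [hg h]].
  destruct (laurent_bounded g hg) as [B [hB hb]].
  exists (B + 1)%R. split; [lra|]. intros z hz.
  generalize (Cmod_le_minus (f z) (g z)) (h z hz) (hb z hz). lra.
Qed.

Lemma unif_of_laurent (f : C -> C) : laurent f -> unif_laurent f.
Proof.
  intros hf eps he. exists f. split; [exact hf|]. intros z _.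
  replace (f z - f z) with (RtoC 0) by ring. now rewrite Cmod_0.
Qed.

Lemma unif_limit (f : C -> C) :
  (forall eps, (0 < eps)%R -> exists g, unif_laurent g /\
     forall z, K z -> (Cmod (f z - g z) < eps)%R) -> unif_laurent f.
Proof.
  intros h eps he. destruct (h (eps / 2)%R ltac:(lra)) as [g [hg hfg]].
  destruct (hg (eps / 2)%R ltac:(lra)) as [g' [hg' hgg]].
  exists g'. split; [exact hg'|]. intros z hz.
  replace (f z - g' z) with ((f z - g z) + (g z - g' z)) by ring.
  eapply Rle_lt_trans; [apply Cmod_triangle|].
  generalize (hfg z hz) (hgg z hz). lra.
Qed.

Lemma unif_ext (f g : C -> C) :
  (forall z, K z -> f z = g z) -> unif_laurent f -> unif_laurent g.
Proof.
  intros h hf eps he. destruct (hf eps he) as [p [hp hpf]].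
  exists p. split; [exact hp|]. intros z hz. rewrite <- h by exact hz. auto.
Qed.

Lemma unif_const (c : C) : unif_laurent (fun _ => c).
Proof. apply unif_of_laurent, laurent_const. Qed.

Lemma unif_id : unif_laurent (fun z => z).
Proof.
  apply unif_of_laurent, (laurent_ext (fun z => z * 1)); [intros; ring|].
  apply laurent_mult_z, laurent_const.
Qed.

Lemma unif_inv_id : unif_laurent (fun z => / z).
Proof.
  apply unif_of_laurent, (laurent_ext (fun z => / z * 1)); [intros; ring|].
  apply laurent_mult_inv, laurent_const.
Qed.

Lemma unif_plus (f g : C -> C) :
  unif_laurent f -> unif_laurent g -> unif_laurent (fun z => f z + g z).
Proof.
  intros hf hg eps he.
  destruct (hf (eps / 2)%R ltac:(lra)) as [f' [hf' ef]].
  destruct (hg (eps / 2)%R ltac:(lra)) as [g' [hg' eg]].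
  exists (fun z => f' z + g' z). split; [now apply laurent_plus|]. intros z hz.
  replace (f z + g z - (f' z + g' z)) with ((f z - f' z) + (g z - g' z)) by ring.
  eapply Rle_lt_trans; [apply Cmod_triangle|].
  generalize (ef z hz) (eg z hz). lra.
Qed.

Lemma unif_mult (f g : C -> C) :
  unif_laurent f -> unif_laurent g -> unif_laurent (fun z => f z * g z).
Proof.
  intros hf hg eps he.
  destruct (unif_bounded f hf) as [B [hB hb]].
  destruct (hg (eps / 2 / B)%R) as [g' [hg' eg]];
    [apply Rdiv_lt_0_compat; lra|].
  (* [g'] is fixed before [f'], because in f g - f' g' = f (g - g') + (f - f') g' the tolerance for
     [f'] depends on the bound of [g']. *)
  destruct (laurent_bounded g' hg') as [B' [hB' hb']].
  destruct (hf (eps / 2 / B')%R) as [f' [hf' ef]];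
    [apply Rdiv_lt_0_compat; lra|].
  exists (fun z => f' z * g' z). split; [now apply laurent_mult|]. intros z hz.
  replace (f z * g z - f' z * g' z) with (f z * (g z - g' z) + (f z - f' z) * g' z) by ring.
  eapply Rle_lt_trans; [apply Cmod_triangle|]. rewrite !Cmod_mult.
  replace eps with (B * (eps / 2 / B) + (eps / 2 / B') * B')%R by (field; lra).
  apply Rplus_lt_le_compat.
  - apply Rle_lt_trans with (B * Cmod (g z - g' z))%R.
    + apply Rmult_le_compat_r; auto using Cmod_ge_0.
    + apply Rmult_lt_compat_l; auto.
  - apply Rmult_le_compat; auto using Cmod_ge_0. left. auto.
Qed.

(* Neumann series. *)
Lemma unif_inv_near_1 (f : C -> C) (rho : R) : (0 <= rho < 1)%R -> unif_laurent f ->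
  (forall z, K z -> (Cmod (f z - 1) <= rho)%R) -> unif_laurent (fun z => / f z).
Proof.
  intros hrho hf h.
  assert (hg : unif_laurent (fun z => 1 - f z)).
  { apply (unif_ext (fun z => 1 + (- (1)) * f z)); [intros; ring|].
    apply unif_plus; [apply unif_const|apply unif_mult; [apply unif_const|exact hf]]. }
  (* [s] is a partial sum of the geometric series in 1 - f; in this form the error 1/f - s equals (1
     - f)^n / f. *)
  assert (hs : forall n, exists s, unif_laurent s /\ forall z, 1 - f z * s z = (1 - f z) ^ n).
  { induction n as [|n [s [hs e]]].
    - exists (fun _ => 0). split; [apply unif_const|]. intros z. simpl. ring.
    - exists (fun z => 1 + (1 - f z) * s z). split.
      + apply unif_plus; [apply unif_const|now apply unif_mult].
      + intros z. rewrite Cpow_S, <- e. ring. }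
  apply unif_limit. intros eps he.
  (* The factor 1 - rho pays for the division by f, since |f| >= 1 - rho. *)
  destruct (pow_lt_1_zero rho) with (y := (eps * (1 - rho))%R) as [n hn].
  { rewrite Rabs_pos_eq; lra. }
  { apply Rmult_lt_0_compat; lra. }
  destruct (hs n) as [s [us e]]. exists s. split; [exact us|]. intros z hz.
  specialize (hn n (le_n _)). rewrite <- RPow_abs, Rabs_pos_eq in hn by lra.
  assert (hm : (Cmod (1 - f z) <= rho)%R) by (rewrite Cmod_minus_sym; auto).
  assert (hfz : (1 - rho <= Cmod (f z))%R).
  { generalize (Cmod_le_minus 1 (f z)). rewrite Cmod_1. lra. }
  assert (hnz : f z <> 0) by (apply Cmod_gt_0; lra).
  replace (/ f z - s z) with (/ f z * (1 - f z) ^ n) by (rewrite <- e; field; exact hnz).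
  rewrite Cmod_mult, Cmod_inv, Cmod_pow by exact hnz.
  apply Rmult_lt_reg_l with (Cmod (f z)); [lra|].
  rewrite <- Rmult_assoc, Rinv_r, Rmult_1_l by lra.
  apply Rle_lt_trans with (rho ^ n)%R; [apply pow_incr; split; [apply Cmod_ge_0|exact hm]|].
  eapply Rlt_le_trans; [exact hn|]. rewrite Rmult_comm. apply Rmult_le_compat_r; lra.
Qed.

Lemma unif_circle_continuous (f : C -> C) (s t : R) : (0 < s)%R ->
  (forall u, K (RtoC s * cis u)) -> unif_laurent f ->
  Ccontinuous (fun u => f (RtoC s * cis u)) t.
Proof.
  intros hs hc hf. apply Ccontinuous_uniform. intros eps he.
  destruct (hf eps he) as [g [hg h]]. exists (fun u => g (RtoC s * cis u)).
  split; [now apply laurent_continuous|]. auto.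
Qed.

(** The counterpart of Cauchy's theorem: a Laurent approximant has the same integral over both
    circles, and [l1] and [l2] are both within 2 pi eps of it. *)
Lemma unif_mean_eq (f : C -> C) (s1 s2 : R) (l1 l2 : C) : (0 < s1)%R -> (0 < s2)%R ->
  (forall u, K (RtoC s1 * cis u)) -> (forall u, K (RtoC s2 * cis u)) ->
  unif_laurent f ->
  is_CRInt (fun u => f (RtoC s1 * cis u)) (- PI) PI l1 ->
  is_CRInt (fun u => f (RtoC s2 * cis u)) (- PI) PI l2 -> l1 = l2.
Proof.
  intros hs1 hs2 hc1 hc2 hf h1 h2.
  assert (hpi := PI_RGT_0).
  assert (hl : forall eps, (0 < eps)%R -> exists l,
    (Cmod (l1 - l) <= 2 * PI * eps)%R /\ (Cmod (l2 - l) <= 2 * PI * eps)%R).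
  { intros eps he. destruct (hf eps he) as [g [hg h]].
    destruct (laurent_mean g hg 0 0) as [l hl]. exists l.
    assert (aux : forall s l', (0 < s)%R -> (forall u, K (RtoC s * cis u)) ->
      is_CRInt (fun u => f (RtoC s * cis u)) (- PI) PI l' -> (Cmod (l' - l) <= 2 * PI * eps)%R).
    { intros s l' hs hc hl'. replace (2 * PI)%R with (PI - - PI)%R by ring.
      apply (is_CRInt_le (fun u => f (RtoC s * cis u) - g (RtoC s * cis u))); [lra| |].
      - intros u _. left. auto.
      - eapply (is_RInt_ext (V := C_R_NormedModule));
          [|exact (is_RInt_minus (V := C_R_NormedModule) _ _ _ _ _ _ hl' (hl s hs))].
        intros u _. C_eq.
        match goal with |- minus ?x ?y = _ => change (minus x y) with (x - y) end. simpl. field. }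
    split; [apply (aux s1)|apply (aux s2)]; assumption. }
  assert (hz : Cmod (l1 - l2) = 0%R).
  { apply Rle_antisym; [|apply Cmod_ge_0]. apply Rnot_lt_le. intros hpos.
    (* With this tolerance the two errors add up to only half of |l1 - l2|. *)
    destruct (hl (Cmod (l1 - l2) / (8 * PI))%R) as [l [e1 e2]];
      [apply Rdiv_lt_0_compat; lra|].
    replace (2 * PI * (Cmod (l1 - l2) / (8 * PI)))%R with (Cmod (l1 - l2) / 4)%R in * by (field; lra).
    assert (Cmod (l1 - l2) <= Cmod (l1 - l) + Cmod (l - l2))%R.
    { eapply Rle_trans; [|apply Cmod_triangle]. right. f_equal. ring. }
    rewrite (Cmod_minus_sym l l2) in *. lra. }
  apply Cmod_eq_0 in hz. rewrite <- (Cplus_0_l l2), <- hz. ring.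
Qed.

End UniformAlgebra.

(** * The weight on the unit circle *)

Section QPochhammerUniform.

Context (q : R) (hq : (0 < q < 1)%R).
Context (K : C -> Prop) (r R0 : R) (hr : (0 < r)%R)
  (hK : forall z, K z -> (r <= Cmod z <= R0)%R).

Let mult := unif_mult K r R0 hr hK.

Lemma unif_qpoch (f : C -> C) (N : nat) :
  unif_laurent K f -> unif_laurent K (fun z => qpoch (f z) q N).
Proof.
  intros hf. induction N; simpl; [apply unif_const|].
  apply mult; [exact IHN|].
  apply (unif_ext K (fun z => 1 + (- RtoC q ^ N) * f z)); [intros; ring|].
  apply unif_plus; [apply unif_const|]. apply mult; [apply unif_const|exact hf].
Qed.

Lemma qpoch_tail_mono (s t : R) (N : nat) : (0 <= s <= t)%R ->
  (qpoch_tail q s N <= qpoch_tail q t N)%R.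
Proof.
  intros h. unfold qpoch_tail.
  assert (h1 := geo_pos q hq). assert (h2 := qpow_le_1 q hq N).
  assert (0 <= s * q ^ N * / (1 - q))%R by (repeat apply Rmult_le_pos; lra).
  apply Rmult_le_compat.
  - left. apply exp_pos.
  - generalize (exp_ineq1_le (s * q ^ N * / (1 - q))). lra.
  - apply exp_le. apply Rmult_le_compat_r; lra.
  - apply Rplus_le_compat_r, exp_le. apply Rmult_le_compat_r; [lra|].
    apply Rmult_le_compat_r; lra.
Qed.

(** The values of f on [K] are bounded, so the finite products converge at a rate independent of
    z. *)
Lemma unif_qpoch_inf (f : C -> C) :
  unif_laurent K f -> unif_laurent K (fun z => qpoch_inf (f z) q).
Proof.
  intros hf. destruct (unif_bounded K r R0 hr hK f hf) as [B [hB hb]].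
  apply unif_limit. intros eps he.
  destruct (qpoch_tail_lim q hq B eps he) as [N hN].
  exists (fun z => qpoch (f z) q N). split; [now apply unif_qpoch|]. intros z hz.
  eapply Rle_lt_trans; [|exact (hN N (le_n _))].
  rewrite Cmod_minus_sym. eapply Rle_trans; [apply qpoch_inf_tail, hq|].
  apply qpoch_tail_mono. split; [apply Cmod_ge_0|auto].
Qed.

Lemma unif_inv_qpoch (f : C -> C) (rho : R) (N : nat) : (0 <= rho < 1)%R ->
  unif_laurent K f -> (forall z, K z -> (Cmod (f z) <= rho)%R) ->
  unif_laurent K (fun z => / qpoch (f z) q N).
Proof.
  intros hrho hf h. induction N; simpl; [apply unif_const|].
  apply (unif_ext K (fun z => / qpoch (f z) q N * / (1 - f z * RtoC q ^ N))).
  { intros z hz. symmetry. specialize (h z hz).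
    assert (hz1 : (Cmod (f z) < 1)%R) by lra.
    assert (h1 := qpoch_nz_lt_1 q hq (f z) N hz1).
    assert (h2 := Cmod_lt_1_nz _ (Cmod_mult_qpow_lt_1 q hq (f z) N hz1)).
    field. split; assumption. }
  apply mult; [exact IHN|]. apply (unif_inv_near_1 K r R0 hr hK _ rho hrho).
  - apply (unif_ext K (fun z => 1 + (- RtoC q ^ N) * f z)); [intros; ring|].
    apply unif_plus; [apply unif_const|]. apply mult; [apply unif_const|exact hf].
  - intros z hz. specialize (h z hz).
    replace (1 - f z * RtoC q ^ N - 1) with (- (f z * RtoC q ^ N)) by ring.
    rewrite Cmod_opp, Cmod_mult_qpow by exact hq.
    generalize (qpow_le_1 q hq N) (Cmod_ge_0 (f z)). nra.
Qed.

(* After finitely many factors the product is within 1/2 of 1. *)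
Lemma unif_inv_qpoch_inf (f : C -> C) (rho : R) : (0 <= rho < 1)%R ->
  unif_laurent K f -> (forall z, K z -> (Cmod (f z) <= rho)%R) ->
  unif_laurent K (fun z => / qpoch_inf (f z) q).
Proof.
  intros hrho hf h.
  destruct (qpoch_inf_near_1 q hq rho (1 / 2) (proj1 hrho) ltac:(lra)) as [N hN].
  apply (unif_ext K (fun z => / qpoch (f z) q N * / qpoch_inf (f z * RtoC q ^ N) q)).
  { intros z hz. rewrite (qpoch_inf_shift q hq (f z) N). specialize (h z hz).
    assert (hz1 : (Cmod (f z) < 1)%R) by lra.
    assert (h1 := qpoch_nz_lt_1 q hq (f z) N hz1).
    assert (h2 := qpoch_inf_nz_lt_1 q hq _ (Cmod_mult_qpow_lt_1 q hq (f z) N hz1)).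
    field. split; assumption. }
  apply mult; [now apply (unif_inv_qpoch f rho)|].
  apply (unif_inv_near_1 K r R0 hr hK _ (1 / 2)); [lra| |auto].
  apply unif_qpoch_inf. apply mult; [exact hf|apply unif_const].
Qed.

End QPochhammerUniform.

(** The weight as a function of z instead of x, which makes it available at every angle and lets
    integrals extend to the full circle. *)
Definition weight_z (q : R) (a b c d z : C) : C :=
  qpochs_inf [z ^ 2; / z ^ 2] q
  / qpochs_inf [a * z; a / z; b * z; b / z; c * z; c / z; d * z; d / z] q.

Lemma zof_cos (t : R) : (0 <= t <= PI)%R -> zof (cos t) = cis t.
Proof. intros h. unfold zof, cis. now rewrite acos_cos. Qed.

Lemma weight_cos (q : R) (a b c d : C) (t : R) : (0 <= t <= PI)%R ->
  weight q a b c d (cos t) = weight_z q a b c d (cis t).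
Proof. intros h. unfold weight, weight_z. now rewrite zof_cos. Qed.

Lemma weight_z_swap (q : R) (a b c d z : C) :
  weight_z q a b c d z = weight_z q b a c d z.
Proof. unfold weight_z, qpochs_inf, Cprod; simpl. apply (f_equal2 Cdiv); ring. Qed.

(** The mass recurrence shifts the first parameter; rotations bring every parameter there. *)
Lemma weight_z_rot (q : R) (a b c d z : C) :
  weight_z q a b c d z = weight_z q b c d a z.
Proof. unfold weight_z, qpochs_inf, Cprod; simpl. apply (f_equal2 Cdiv); ring. Qed.

Lemma weight_z_inv (q : R) (a b c d z : C) : z <> 0 ->
  weight_z q a b c d (/ z) = weight_z q a b c d z.
Proof.
  intros hz. unfold weight_z, qpochs_inf, Cprod, Cdiv; simpl.
  replace (/ z * (/ z * 1)) with (/ (z * (z * 1))) by (field; exact hz).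
  replace (/ / z) with z by (field; exact hz).
  replace (/ / (z * (z * 1))) with (z * (z * 1)) by (field; exact hz).
  apply (f_equal2 Cmult); [ring|]. apply f_equal. ring.
Qed.

Section Weight.

Context (q : R) (hq : (0 < q < 1)%R).

Lemma Cmod_mult_lt_1 (a z : C) : (Cmod a < 1)%R -> (Cmod z <= 1)%R -> (Cmod (a * z) < 1)%R.
Proof.
  intros ha hz. rewrite Cmod_mult. generalize (Cmod_ge_0 a) (Cmod_ge_0 z). nra.
Qed.

Lemma Cmod_inv_circle (z : C) : Cmod z = 1%R -> z <> 0 /\ Cmod (/ z) = 1%R.
Proof.
  intros hz. assert (z <> 0) by (apply Cmod_gt_0; lra). split; [easy|].
  rewrite Cmod_inv, hz by easy. field.
Qed.

Lemma denominator_pair_nz (a z : C) : (Cmod a < 1)%R -> Cmod z = 1%R ->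
  qpoch_inf (a * z) q <> 0 /\ qpoch_inf (a / z) q <> 0.
Proof.
  intros ha hz. destruct (Cmod_inv_circle z hz) as [_ hi].
  split; apply qpoch_inf_nz_lt_1; try exact hq; apply Cmod_mult_lt_1; lra.
Qed.

Lemma weight_z_shift_1 (a b c d z : C) :
  (Cmod a < 1)%R -> (Cmod b < 1)%R -> (Cmod c < 1)%R -> (Cmod d < 1)%R -> Cmod z = 1%R ->
  weight_z q (a * RtoC q) b c d z = (1 - a * z) * (1 - a / z) * weight_z q a b c d z.
Proof.
  intros ha hb hc hd hz.
  destruct (denominator_pair_nz a z ha hz) as [a1 a2].
  destruct (denominator_pair_nz b z hb hz) as [b1 b2].
  destruct (denominator_pair_nz c z hc hz) as [c1 c2].
  destruct (denominator_pair_nz d z hd hz) as [d1 d2].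
  unfold weight_z, qpochs_inf, Cprod; simpl.
  rewrite (qpoch_inf_shift_1 q hq (a * z)) in a1 |- *.
  rewrite (qpoch_inf_shift_1 q hq (a / z)) in a2 |- *.
  replace (a * RtoC q * z) with (a * z * RtoC q) by ring.
  replace (a * RtoC q / z) with (a / z * RtoC q) by (unfold Cdiv; ring).
  assert (u1 : 1 - a * z <> 0) by (intros e; apply a1; rewrite e; ring).
  assert (u2 : 1 - a / z <> 0) by (intros e; apply a2; rewrite e; ring).
  assert (u3 : qpoch_inf (a * z * RtoC q) q <> 0) by (intros e; apply a1; rewrite e; ring).
  assert (u4 : qpoch_inf (a / z * RtoC q) q <> 0) by (intros e; apply a2; rewrite e; ring).
  set (u := 1 - a * z) in *. set (v := 1 - a / z) in *.
  set (A := qpoch_inf (a * z * RtoC q) q) in *. set (A' := qpoch_inf (a / z * RtoC q) q) in *.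
  set (B := qpoch_inf (b * z) q) in *. set (B' := qpoch_inf (b / z) q) in *.
  set (c' := qpoch_inf (c * z) q) in *. set (c'' := qpoch_inf (c / z) q) in *.
  set (D := qpoch_inf (d * z) q) in *. set (D' := qpoch_inf (d / z) q) in *.
  field. repeat split; assumption.
Qed.

Lemma unif_weight_z (a b c d : C) :
  (Cmod a < 1)%R -> (Cmod b < 1)%R -> (Cmod c < 1)%R -> (Cmod d < 1)%R ->
  unif_laurent (fun z => Cmod z = 1%R) (weight_z q a b c d).
Proof.
  intros ha hb hc hd.
  set (K := fun z => Cmod z = 1%R).
  assert (hK : forall z, K z -> (1 <= Cmod z <= 1)%R) by (unfold K; intros; lra).
  assert (mult := unif_mult K 1 1 Rlt_0_1 hK).
  assert (hi := unif_qpoch_inf q hq K 1 1 Rlt_0_1 hK).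
  assert (pair : forall e, (Cmod e < 1)%R -> unif_laurent K (fun z => / qpoch_inf (e * z) q)
     /\ unif_laurent K (fun z => / qpoch_inf (e * / z) q)).
  { intros e he. assert (0 <= Cmod e < 1)%R by (split; [apply Cmod_ge_0|exact he]).
    split; apply (unif_inv_qpoch_inf q hq K 1 1 Rlt_0_1 hK _ (Cmod e)); auto.
    - apply mult; [apply unif_const|apply unif_id].
    - intros z hz. rewrite Cmod_mult, hz. lra.
    - apply mult; [apply unif_const|apply unif_inv_id].
    - intros z hz. rewrite Cmod_mult, (proj2 (Cmod_inv_circle z hz)). lra. }
  destruct (pair a ha) as [a1 a2], (pair b hb) as [b1 b2],
    (pair c hc) as [c1 c2], (pair d hd) as [d1 d2].
  apply (unif_ext K (fun z => (qpoch_inf (z * z) q * qpoch_inf (/ z * / z) q) *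
    ((/ qpoch_inf (a * z) q * / qpoch_inf (a * / z) q) *
     ((/ qpoch_inf (b * z) q * / qpoch_inf (b * / z) q) *
     ((/ qpoch_inf (c * z) q * / qpoch_inf (c * / z) q) *
     (/ qpoch_inf (d * z) q * / qpoch_inf (d * / z) q)))))).
  - intros z hz. destruct (Cmod_inv_circle z hz) as [hz0 _].
    destruct (denominator_pair_nz a z ha hz) as [e1 e2].
    destruct (denominator_pair_nz b z hb hz) as [e3 e4].
    destruct (denominator_pair_nz c z hc hz) as [e5 e6].
    destruct (denominator_pair_nz d z hd hz) as [e7 e8].
    unfold weight_z, qpochs_inf, Cprod, Cdiv in *; simpl.
    replace (/ z * / z) with (/ (z * (z * 1))) by (field; exact hz0).
    replace (z * (z * 1)) with (z * z) by ring.
    set (A := qpoch_inf (a * z) q) in *. set (A' := qpoch_inf (a * / z) q) in *.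
    set (B := qpoch_inf (b * z) q) in *. set (B' := qpoch_inf (b * / z) q) in *.
    set (c' := qpoch_inf (c * z) q) in *. set (c'' := qpoch_inf (c * / z) q) in *.
    set (D := qpoch_inf (d * z) q) in *. set (D' := qpoch_inf (d * / z) q) in *.
    field. repeat split; assumption.
  - apply mult; [apply mult; apply hi; apply mult; (apply unif_id || apply unif_inv_id)|].
    repeat apply mult; assumption.
Qed.

(* The weight with the factors [1 - a/z], ..., [1 - 1/z^2] removed, so that it extends to
   the annulus [q <= |z| <= 1]. *)
Definition annulus_kernel (a b c d z : C) : C :=
  z * (qpoch_inf (z * z) q * qpoch_inf (RtoC q * (/ z * / z)) q) *
    ((/ qpoch_inf (a * z) q * / qpoch_inf (RtoC q * a * / z) q) *
     ((/ qpoch_inf (b * z) q * / qpoch_inf (RtoC q * b * / z) q) *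
     ((/ qpoch_inf (c * z) q * / qpoch_inf (RtoC q * c * / z) q) *
     (/ qpoch_inf (d * z) q * / qpoch_inf (RtoC q * d * / z) q)))).

Definition annulus (z : C) : Prop := (q <= Cmod z <= 1)%R.

(** The factor q in qa/z gives |qa/z| <= |a| < 1 as soon as |z| >= q, so the inverse products remain
    uniform limits up to the inner circle. *)
Lemma unif_annulus_kernel (a b c d : C) :
  (Cmod a < 1)%R -> (Cmod b < 1)%R -> (Cmod c < 1)%R -> (Cmod d < 1)%R ->
  unif_laurent annulus (annulus_kernel a b c d).
Proof.
  intros ha hb hc hd.
  assert (hK : forall z, annulus z -> (q <= Cmod z <= 1)%R) by auto.
  assert (mult := unif_mult annulus q 1 (proj1 hq) hK).
  assert (hi := unif_qpoch_inf q hq annulus q 1 (proj1 hq) hK).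
  assert (pair : forall e, (Cmod e < 1)%R -> unif_laurent annulus (fun z => / qpoch_inf (e * z) q)
     /\ unif_laurent annulus (fun z => / qpoch_inf (RtoC q * e * / z) q)).
  { intros e he. assert (h0 : (0 <= Cmod e < 1)%R) by (split; [apply Cmod_ge_0|exact he]).
    split; apply (unif_inv_qpoch_inf q hq annulus q 1 (proj1 hq) hK _ (Cmod e)); auto.
    - apply mult; [apply unif_const|apply unif_id].
    - intros z [_ hz]. rewrite Cmod_mult. generalize (Cmod_ge_0 z). nra.
    - apply mult; [apply unif_const|apply unif_inv_id].
    - intros z [hz _].
      rewrite !Cmod_mult, Cmod_inv, Cmod_R, Rabs_pos_eq by (try apply Cmod_gt_0; lra).
      apply Rmult_le_reg_r with (Cmod z); [lra|].
      rewrite Rmult_assoc, Rinv_l by lra. nra. }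
  destruct (pair a ha) as [a1 a2], (pair b hb) as [b1 b2],
    (pair c hc) as [c1 c2], (pair d hd) as [d1 d2].
  unfold annulus_kernel. apply mult; [|repeat apply mult; assumption].
  apply mult; [apply unif_id|]. apply mult; apply hi.
  - apply mult; apply unif_id.
  - apply mult; [apply unif_const|]. apply mult; apply unif_inv_id.
Qed.

(** The kernel satisfies K(qz) = - K(1/z), so the difference is K(z) + K(1/z): the weight times the
    symmetrization of z (1 - a/z)(1 - b/z)(1 - c/z)(1 - d/z) / (1 - 1/z^2). In it the second
    elementary symmetric function of a, b, c, d cancels and the division by z^2 - 1 is exact, which
    leaves degree one in z + 1/z. *)
Lemma annulus_kernel_difference (a b c d z : C) :
  (Cmod a < 1)%R -> (Cmod b < 1)%R -> (Cmod c < 1)%R -> (Cmod d < 1)%R -> Cmod z = 1%R ->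
  annulus_kernel a b c d z - annulus_kernel a b c d (RtoC q * z) =
  ((1 - a * b * c * d) * (z + / z)
   - (a + b + c + d - (a * b * c + a * b * d + a * c * d + b * c * d)))
  * weight_z q a b c d z.
Proof.
  intros ha hb hc hd hz.
  destruct (Cmod_inv_circle z hz) as [hz0 _].
  assert (hq0 := q_nz q hq).
  set (P := qpoch_inf (z * z * RtoC q * RtoC q) q).
  set (Q := qpoch_inf (RtoC q * (/ z * / z)) q).
  assert (eP : qpoch_inf (z * z) q = (1 - z * z) * (1 - z * z * RtoC q) * P).
  { rewrite (qpoch_inf_shift_1 q hq (z * z)), (qpoch_inf_shift_1 q hq (z * z * RtoC q)).
    unfold P. ring. }
  assert (eQ : qpoch_inf (/ z * / z) q = (1 - / z * / z) * Q).
  { rewrite (qpoch_inf_shift_1 q hq (/ z * / z)). unfold Q.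
    now rewrite (Cmult_comm (RtoC q)). }
  assert (eQ' : qpoch_inf (/ RtoC q * (/ z * / z)) q
                = (1 - / RtoC q * (/ z * / z)) * (1 - / z * / z) * Q).
  { rewrite (qpoch_inf_shift_1 q hq (/ RtoC q * (/ z * / z))).
    replace (/ RtoC q * (/ z * / z) * RtoC q) with (/ z * / z) by (field; auto).
    rewrite eQ. ring. }
  assert (pair : forall e, (Cmod e < 1)%R -> exists X Y : C, X <> 0 /\ Y <> 0 /\
    1 - e * z <> 0 /\ 1 - e * / z <> 0 /\
    qpoch_inf (e * z) q = (1 - e * z) * X /\ qpoch_inf (e * (RtoC q * z)) q = X /\
    qpoch_inf (e * / z) q = (1 - e * / z) * Y /\ qpoch_inf (RtoC q * e * / z) q = Y).
  { intros e he. destruct (denominator_pair_nz e z he hz) as [n1 n2]. unfold Cdiv in n2.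
    exists (qpoch_inf (e * (RtoC q * z)) q), (qpoch_inf (RtoC q * e * / z) q).
    rewrite (qpoch_inf_shift_1 q hq (e * z)) in n1 |- *.
    rewrite (qpoch_inf_shift_1 q hq (e * / z)) in n2 |- *.
    replace (e * (RtoC q * z)) with (e * z * RtoC q) by ring.
    replace (RtoC q * e * / z) with (e * / z * RtoC q) by ring.
    repeat split; intros h; try rewrite h in n1; try rewrite h in n2;
      (apply n1; ring) || (apply n2; ring). }
  destruct (pair a ha) as (A & A' & a1 & a2 & a3 & a4 & a5 & a6 & a7 & a8).
  destruct (pair b hb) as (B & B' & b1 & b2 & b3 & b4 & b5 & b6 & b7 & b8).
  destruct (pair c hc) as (X & X' & c1 & c2 & c3 & c4 & c5 & c6 & c7 & c8).
  destruct (pair d hd) as (D & D' & d1 & d2 & d3 & d4 & d5 & d6 & d7 & d8).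
  unfold weight_z, qpochs_inf, Cprod, Cdiv, annulus_kernel; simpl.
  replace (RtoC q * z * (RtoC q * z)) with (z * z * RtoC q * RtoC q) by ring.
  replace (RtoC q * (/ (RtoC q * z) * / (RtoC q * z))) with (/ RtoC q * (/ z * / z))
    by (field; auto).
  replace (z * (z * 1)) with (z * z) by ring.
  replace (/ (z * z)) with (/ z * / z) by (field; auto).
  assert (e' : forall e, RtoC q * e * / (RtoC q * z) = e * / z) by (intros; field; auto).
  rewrite !e'. fold P Q. rewrite eP, eQ, eQ'.
  rewrite a5, a6, a7, a8, b5, b6, b7, b8, c5, c6, c7, c8, d5, d6, d7, d8.
  (* [Y] collects the infinite products; what remains is a rational identity in z. *)
  set (Y := P * Q * / (A * A' * B * B' * X * X' * D * D')).
  transitivity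
    (Y * / ((1 - a * z) * (1 - a * / z) * ((1 - b * z) * (1 - b * / z)) *
           ((1 - c * z) * (1 - c * / z)) * ((1 - d * z) * (1 - d * / z))) *
     (z * (1 - z * z) * (1 - z * z * RtoC q) *
       ((1 - a * / z) * (1 - b * / z) * (1 - c * / z) * (1 - d * / z)) -
      RtoC q * z * (1 - / RtoC q * (/ z * / z)) * (1 - / z * / z) *
       ((1 - a * z) * (1 - b * z) * (1 - c * z) * (1 - d * z)))).
  { unfold Y. clear - a1 a2 a3 a4 b1 b2 b3 b4 c1 c2 c3 c4 d1 d2 d3 d4.
    set (iz := / z) in *. set (iq := / RtoC q).
    set (ua := 1 - a * z) in *. set (va := 1 - a * iz) in *.
    set (ub := 1 - b * z) in *. set (vb := 1 - b * iz) in *.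
    set (uc := 1 - c * z) in *. set (vc := 1 - c * iz) in *.
    set (ud := 1 - d * z) in *. set (vd := 1 - d * iz) in *.
    field. repeat split; assumption. }
  (* The bracket factors: since q z (1 - 1/(q z^2)) = - (1 - q z^2)/z, both of its terms contain 1 -
     q z^2, and the rest is the symmetrization. *)
  transitivity
    (Y * / ((1 - a * z) * (1 - a * / z) * ((1 - b * z) * (1 - b * / z)) *
           ((1 - c * z) * (1 - c * / z)) * ((1 - d * z) * (1 - d * / z))) *
     (((1 - a * b * c * d) * (z + / z)
       - (a + b + c + d - (a * b * c + a * b * d + a * c * d + b * c * d))) *
      ((1 - z * z) * (1 - z * z * RtoC q) * (1 - / z * / z)))).
  { f_equal. field. auto. }
  unfold Y. clear - a1 a2 a3 a4 b1 b2 b3 b4 c1 c2 c3 c4 d1 d2 d3 d4.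
  set (iz := / z) in *.
  set (ua := 1 - a * z) in *. set (va := 1 - a * iz) in *.
  set (ub := 1 - b * z) in *. set (vb := 1 - b * iz) in *.
  set (uc := 1 - c * z) in *. set (vc := 1 - c * iz) in *.
  set (ud := 1 - d * z) in *. set (vd := 1 - d * iz) in *.
  set (G := _ - (a + b + c + d - _)).
  field. repeat split; assumption.
Qed.

End Weight.

(** * The total mass of the weight *)

Lemma RInt_CRInt (f : R -> C) (a b : R) : (forall t, Ccontinuous f t) ->
  is_CRInt f a b (RInt (V := C_R_CompleteNormedModule) f a b).
Proof.
  intros h. apply (RInt_correct (V := C_R_CompleteNormedModule)).
  apply (ex_RInt_continuous (V := C_R_CompleteNormedModule)).
  intros t _. apply (Ccontinuous_continuous f t), h.
Qed.

Lemma RInt_CRInt_unique (f : R -> C) (a b : R) (l : C) : is_CRInt f a b l ->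
  RInt (V := C_R_CompleteNormedModule) f a b = l.
Proof. exact (is_RInt_unique (V := C_R_CompleteNormedModule) f a b l). Qed.

(** Bridges the full circle, where means are compared, and the half circle [0, pi] of the
    functional. *)
Lemma CRInt_even (f : R -> C) (b : R) (l l' : C) : (forall t, f (- t)%R = f t) ->
  is_CRInt f 0 b l -> is_CRInt f (- b) b l' -> l' = l + l.
Proof.
  intros he h h'.
  assert (h2 : is_CRInt f (- b) 0 l).
  { assert (h3 := is_RInt_comp_opp (V := C_R_NormedModule) f (- b) 0 (opp l)).
    rewrite Ropp_0, Ropp_involutive in h3.
    assert (h4 := is_RInt_opp (V := C_R_NormedModule) _ _ _ _
      (h3 (is_RInt_swap (V := C_R_NormedModule) _ _ _ _ h))).
    replace l with (opp (opp l)) by apply (opp_opp (G := C_R_NormedModule)).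
    eapply (is_RInt_ext (V := C_R_NormedModule)); [|exact h4].
    intros t _. etransitivity; [apply (opp_opp (G := C_R_NormedModule))|apply he]. }
  rewrite <- (RInt_CRInt_unique _ _ _ _ h').
  apply RInt_CRInt_unique.
  exact (is_RInt_Chasles (V := C_R_NormedModule) f (- b) 0 b l l h2 h).
Qed.

Section WeightIntegral.

Context (q : R) (hq : (0 < q < 1)%R).

(** [g] depends on the angle and not on x, so that z + 1/z is integrated as it stands; the factor
    1/(2 pi) is left out. *)
Definition wint (a b c d : C) (g : R -> C) : C :=
  RInt (V := C_R_CompleteNormedModule)
    (fun t : R => g t * weight_z q a b c d (cis t)) 0 PI.

Lemma weight_integral_wint (a b c d : C) (f : R -> C) :
  weight_integral q a b c d f = / RtoC (2 * PI) * wint a b c d (fun t => f (cos t)).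
Proof.
  unfold weight_integral, wint. apply (f_equal (Cmult _)).
  apply (RInt_ext (V := C_R_CompleteNormedModule)). intros t ht.
  rewrite Rmin_left, Rmax_right in ht by (left; apply PI_RGT_0).
  apply (f_equal (Cmult _)). apply weight_cos. lra.
Qed.

Lemma wint_ext (a b c d a' b' c' d' : C) (f g : R -> C) :
  (forall t, (0 < t < PI)%R ->
     f t * weight_z q a b c d (cis t) = g t * weight_z q a' b' c' d' (cis t)) ->
  wint a b c d f = wint a' b' c' d' g.
Proof.
  intros h. apply (RInt_ext (V := C_R_CompleteNormedModule)). intros t ht.
  rewrite Rmin_left, Rmax_right in ht by (left; apply PI_RGT_0).
  apply h, ht.
Qed.

(** This is 2 pi times the Askey-Wilson integral. It enters through its behaviour under a -> aq and
    its non-vanishing. *)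
Definition mass (a b c d : C) : C := wint a b c d (fun _ => 1).

Lemma mass_rot (a b c d : C) : mass a b c d = mass b c d a.
Proof.
  unfold mass. apply wint_ext. intros t _. rewrite (weight_z_rot q a b). reflexivity.
Qed.

Section FirstMoment.

Context (a b c d : C) (ha : (Cmod a < 1)%R) (hb : (Cmod b < 1)%R)
  (hc : (Cmod c < 1)%R) (hd : (Cmod d < 1)%R).

Lemma weight_cis_continuous (t : R) : Ccontinuous (fun s => weight_z q a b c d (cis s)) t.
Proof.
  apply (Ccontinuous_ext (fun s => weight_z q a b c d (RtoC 1 * cis s))).
  { intros s. now rewrite Cmult_1_l. }
  apply (unif_circle_continuous (fun z => Cmod z = 1%R)); [lra| |].
  - intros u. now rewrite Cmult_1_l, Cmod_cis.
  - now apply unif_weight_z.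
Qed.

Lemma wint_correct (g : R -> C) : (forall t, Ccontinuous g t) ->
  is_CRInt (fun t => g t * weight_z q a b c d (cis t)) 0 PI (wint a b c d g).
Proof.
  intros hg. apply RInt_CRInt. intros t.
  apply Ccontinuous_mult; [apply hg|apply weight_cis_continuous].
Qed.

Lemma wint_plus (f g : R -> C) :
  (forall t, Ccontinuous f t) -> (forall t, Ccontinuous g t) ->
  wint a b c d (fun t => f t + g t) = wint a b c d f + wint a b c d g.
Proof.
  intros hf hg. apply RInt_CRInt_unique.
  eapply (is_RInt_ext (V := C_R_NormedModule));
    [|exact (is_RInt_plus (V := C_R_NormedModule) _ _ _ _ _ _ (wint_correct f hf) (wint_correct g hg))].
  intros t _. C_eq.
  match goal with |- plus ?x ?y = _ => change (plus x y) with (x + y) end. ring.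
Qed.

Lemma wint_scal (k : C) (f : R -> C) : (forall t, Ccontinuous f t) ->
  wint a b c d (fun t => k * f t) = k * wint a b c d f.
Proof.
  intros hf. apply RInt_CRInt_unique.
  eapply (is_RInt_ext (V := C_R_NormedModule)); [|exact (is_CRInt_mult _ _ _ k _ (wint_correct f hf))].
  intros t _. C_eq. ring.
Qed.

Lemma Ccontinuous_z_plus_inv (t : R) : Ccontinuous (fun t => cis t + / cis t) t.
Proof.
  apply Ccontinuous_plus; [apply Ccontinuous_cis|].
  apply (Ccontinuous_ext (fun s => cis (- s))).
  - intros s. now rewrite cis_inv.
  - apply Ccontinuous_cis_opp.
Qed.

Lemma annulus_kernel_mean_eq (l1 l2 : C) :
  is_CRInt (fun t => annulus_kernel q a b c d (RtoC 1 * cis t)) (- PI) PI l1 ->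
  is_CRInt (fun t => annulus_kernel q a b c d (RtoC q * cis t)) (- PI) PI l2 -> l1 = l2.
Proof.
  apply (unif_mean_eq (annulus q)); try lra.
  - intros u. rewrite Cmult_1_l. unfold annulus. rewrite Cmod_cis. lra.
  - intros u. unfold annulus. rewrite Cmod_mult, Cmod_cis, Cmod_R, Rabs_pos_eq; lra.
  - now apply unif_annulus_kernel.
Qed.

(* Integrate [annulus_kernel_difference]: the left-hand side has mean zero. *)
Lemma first_moment :
  (1 - a * b * c * d) * wint a b c d (fun t => cis t + / cis t)
  = (a + b + c + d - (a * b * c + a * b * d + a * c * d + b * c * d)) * mass a b c d.
Proof.
  set (e := a + b + c + d - (a * b * c + a * b * d + a * c * d + b * c * d)).
  set (g := fun t => (1 - a * b * c * d) * (cis t + / cis t) - e).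
  assert (hcont : forall s t, (q <= s <= 1)%R ->
    Ccontinuous (fun u => annulus_kernel q a b c d (RtoC s * cis u)) t).
  { intros s t hs. apply (unif_circle_continuous (annulus q)); [lra| |now apply unif_annulus_kernel].
    intros u. unfold annulus. rewrite Cmod_mult, Cmod_cis, Cmod_R, Rabs_pos_eq; lra. }
  assert (i1 := RInt_CRInt _ (- PI) PI (fun t => hcont 1%R t ltac:(lra))).
  assert (i2 := RInt_CRInt _ (- PI) PI (fun t => hcont q t ltac:(lra))).
  assert (e12 := annulus_kernel_mean_eq _ _ i1 i2).
  assert (i3 := is_RInt_minus (V := C_R_NormedModule) _ _ _ _ _ _ i1 i2).
  assert (i4 : is_CRInt (fun t => g t * weight_z q a b c d (cis t)) (- PI) PI (RtoC 0)).
  { replace (RtoC 0) with (minus (G := C_R_NormedModule)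
      (RInt (V := C_R_CompleteNormedModule)
        (fun u => annulus_kernel q a b c d (RtoC 1 * cis u)) (- PI) PI)
      (RInt (V := C_R_CompleteNormedModule)
        (fun u => annulus_kernel q a b c d (RtoC q * cis u)) (- PI) PI)).
    - eapply (is_RInt_ext (V := C_R_NormedModule)); [|exact i3].
      intros t _. C_eq.
      match goal with |- minus ?x ?y = _ => change (minus x y) with (x - y) end.
      rewrite Cmult_1_l, (annulus_kernel_difference q hq); auto. apply Cmod_cis.
    - rewrite e12. apply (minus_eq_zero (G := C_R_NormedModule)). }
  assert (hg : forall t, Ccontinuous g t).
  { intros t. unfold g. apply Ccontinuous_plus; [|apply Ccontinuous_const].
    apply Ccontinuous_mult; [apply Ccontinuous_const|apply Ccontinuous_z_plus_inv]. }
  assert (hge : forall t, g (- t)%R * weight_z q a b c d (cis (- t))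
                          = g t * weight_z q a b c d (cis t)).
  { intros t. unfold g. assert (ht : cis (- t) = / cis t) by (now rewrite cis_inv).
    rewrite ht, weight_z_inv by apply cis_nz.
    replace (/ / cis t) with (cis t) by (field; apply cis_nz).
    now rewrite (Cplus_comm (/ cis t)). }
  (* The weight and z + 1/z are invariant under z -> 1/z, so the vanishing integral over the full
     circle is twice the one over [0, pi]. *)
  assert (i5 := CRInt_even _ PI _ _ hge (wint_correct g hg) i4).
  assert (i6 : wint a b c d g = 0).
  { replace (wint a b c d g) with ((wint a b c d g + wint a b c d g) / 2).
    - rewrite <- i5. field.
    - field. }
  assert (i7 : wint a b c d g = (1 - a * b * c * d) * wint a b c d (fun t => cis t + / cis t)
     + (- e) * mass a b c d).
  { unfold mass. rewrite <- !wint_scal, <- wint_plus.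
    - apply wint_ext. intros t _. unfold g. ring.
    - intros t. apply Ccontinuous_mult; [apply Ccontinuous_const|apply Ccontinuous_z_plus_inv].
    - intros t. apply Ccontinuous_mult; apply Ccontinuous_const.
    - intros t. apply Ccontinuous_const.
    - apply Ccontinuous_z_plus_inv. }
  rewrite i6 in i7.
  rewrite <- (Cplus_0_r (_ * wint a b c d _)).
  replace (RtoC 0) with ((- e) * mass a b c d + e * mass a b c d) by ring.
  rewrite Cplus_assoc, <- i7. ring.
Qed.

(** Since (1 - az)(1 - a/z) = 1 + a^2 - a (z + 1/z), the shifted mass combines the mass and the
    first moment. After multiplication by 1 - abcd the first moment is eliminated and the
    coefficient factors as (1 - ab)(1 - ac)(1 - ad). *)
Lemma mass_shift_1 :
  (1 - a * b * c * d) * mass (a * RtoC q) b c d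
  = (1 - a * b) * (1 - a * c) * (1 - a * d) * mass a b c d.
Proof.
  assert (h : mass (a * RtoC q) b c d
    = (1 + a * a) * mass a b c d + (- a) * wint a b c d (fun t => cis t + / cis t)).
  { unfold mass. rewrite <- !wint_scal, <- wint_plus.
    - apply wint_ext. intros t _. rewrite (weight_z_shift_1 q hq) by auto using Cmod_cis.
      field. apply cis_nz.
    - intros t. apply Ccontinuous_mult; apply Ccontinuous_const.
    - intros t. apply Ccontinuous_mult; [apply Ccontinuous_const|apply Ccontinuous_z_plus_inv].
    - apply Ccontinuous_z_plus_inv.
    - intros t. apply Ccontinuous_const. }
  rewrite h, Cmult_plus_distr_l.
  replace ((1 - a * b * c * d) * (- a * wint a b c d (fun t => cis t + / cis t)))
    with (- a * ((1 - a * b * c * d) * wint a b c d (fun t => cis t + / cis t))) by ring.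
  rewrite first_moment. ring.
Qed.

End FirstMoment.

Lemma Cmod_mult2_lt_1 (a b : C) : (Cmod a < 1 -> Cmod b < 1 -> Cmod (a * b) < 1)%R.
Proof. intros. apply Cmod_mult_lt_1; lra. Qed.

Lemma mass_shift (a b c d : C) (j : nat) :
  (Cmod a < 1)%R -> (Cmod b < 1)%R -> (Cmod c < 1)%R -> (Cmod d < 1)%R ->
  qpoch (a * b * c * d) q j * mass (a * RtoC q ^ j) b c d
  = qpoch (a * b) q j * qpoch (a * c) q j * qpoch (a * d) q j * mass a b c d.
Proof.
  intros ha hb hc hd. induction j.
  - simpl. rewrite !Cmult_1_l, Cmult_1_r. reflexivity.
  - assert (h := mass_shift_1 (a * RtoC q ^ j) b c d (Cmod_mult_qpow_lt_1 q hq a j ha) hb hc hd).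
    simpl. replace (a * (RtoC q * RtoC q ^ j)) with (a * RtoC q ^ j * RtoC q) by ring.
    replace (a * RtoC q ^ j * b * c * d) with (a * b * c * d * RtoC q ^ j) in h by ring.
    rewrite <- Cmult_assoc, h.
    transitivity ((1 - a * RtoC q ^ j * b) * (1 - a * RtoC q ^ j * c) * (1 - a * RtoC q ^ j * d) *
      (qpoch (a * b * c * d) q j * mass (a * RtoC q ^ j) b c d)); [ring|].
    rewrite IHj. ring.
Qed.

(** Rests on (abcd;q)_j being nonzero. In this direction a zero mass is pushed to arbitrarily small
    parameters. *)
Lemma mass_zero_shift (a b c d : C) (j : nat) :
  (Cmod a < 1)%R -> (Cmod b < 1)%R -> (Cmod c < 1)%R -> (Cmod d < 1)%R ->
  mass a b c d = 0 -> mass (a * RtoC q ^ j) b c d = 0.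
Proof.
  intros ha hb hc hd h. assert (e := mass_shift a b c d j ha hb hc hd).
  rewrite h, Cmult_0_r in e.
  destruct (Ceq_dec (mass (a * RtoC q ^ j) b c d) 0) as [|n]; [assumption|].
  exfalso. apply (Cmult_neq_0 (qpoch (a * b * c * d) q j) _) in n; [auto|].
  apply (qpoch_nz_lt_1 q hq). repeat apply Cmod_mult2_lt_1; assumption.
Qed.

(* With all parameters small the integrand has positive real part, so the mass of the
   shifted weight, which is a multiple of the original one, cannot vanish. *)
Lemma mass_nz (a b c d : C) :
  (Cmod a < 1)%R -> (Cmod b < 1)%R -> (Cmod c < 1)%R -> (Cmod d < 1)%R ->
  mass a b c d <> 0.
Proof.
  intros ha hb hc hd h0.
  (* Eight denominator factors within 1/20 of 1 give |D - 1| <= (21/20)^8 - 1 < 1. *)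
  destruct (qpoch_inf_near_1 q hq 1 (1 / 20) ltac:(lra) ltac:(lra)) as [N hN].
  assert (near : forall e, (Cmod e < 1)%R -> (Cmod (e * RtoC q ^ N) < 1)%R)
    by (intros; apply Cmod_mult_qpow_lt_1; assumption).
  assert (hz : mass (a * RtoC q ^ N) (b * RtoC q ^ N) (c * RtoC q ^ N) (d * RtoC q ^ N) = 0).
  (* Four shifts, each followed by a rotation; after the fourth the parameters are back in their
     original order. *)
  { apply mass_zero_shift; auto. rewrite mass_rot.
    apply mass_zero_shift; auto. rewrite mass_rot.
    apply mass_zero_shift; auto. rewrite mass_rot.
    apply mass_zero_shift; auto. rewrite mass_rot. exact h0. }
  assert (hint := wint_correct _ _ _ _ (near a ha) (near b hb) (near c hc) (near d hd)
     (fun _ => 1) (fun t => Ccontinuous_const 1 t)).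
  fold (mass (a * RtoC q ^ N) (b * RtoC q ^ N) (c * RtoC q ^ N) (d * RtoC q ^ N)) in hint.
  rewrite hz in hint.
  apply (is_RInt_fct_extend_fst (U := R_NormedModule) (V := R_NormedModule)) in hint.
  apply (is_RInt_unique (V := R_CompleteNormedModule)) in hint. change (fst (RtoC 0)) with 0%R in hint.
  assert (hpos : (0 < RInt (fun t => fst (1 * weight_z q (a * RtoC q ^ N) (b * RtoC q ^ N)
      (c * RtoC q ^ N) (d * RtoC q ^ N) (cis t))%C) 0 PI)%R);
    [|exact (Rlt_irrefl 0 (Rlt_le_trans _ _ _ hpos (Req_le _ _ hint)))].
  apply RInt_gt_0; [apply PI_RGT_0| |].
  - intros t ht. rewrite Cmult_1_l. unfold weight_z, qpochs_inf, Cprod.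
    cbn [map fold_right].
    assert (fac : forall e, (Cmod e < 1)%R ->
      (Cmod (qpoch_inf (e * RtoC q ^ N * cis t) q - 1) <= 21/20 - 1)%R /\
      (Cmod (qpoch_inf (e * RtoC q ^ N / cis t) q - 1) <= 21/20 - 1)%R).
    { intros e he.
      replace (e * RtoC q ^ N * cis t) with (e * cis t * RtoC q ^ N) by ring.
      replace (e * RtoC q ^ N / cis t) with (e * / cis t * RtoC q ^ N) by (unfold Cdiv; ring).
      split; (eapply Rle_trans; [apply hN|lra]).
      - rewrite Cmod_mult, Cmod_cis. lra.
      - rewrite cis_inv, Cmod_mult, Cmod_cis. lra. }
    destruct (fac a ha) as [a1 a2], (fac b hb) as [b1 b2],
      (fac c hc) as [c1 c2], (fac d hd) as [d1 d2]. clear fac.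
    assert (one : (Cmod (1 - 1) <= 1 - 1)%R)
      by (replace (1 - 1) with (RtoC 0) by ring; rewrite Cmod_0; lra).
    assert (hD := Cmod_mult_minus_1 _ _ _ _ a1 (Cmod_mult_minus_1 _ _ _ _ a2
      (Cmod_mult_minus_1 _ _ _ _ b1 (Cmod_mult_minus_1 _ _ _ _ b2
      (Cmod_mult_minus_1 _ _ _ _ c1 (Cmod_mult_minus_1 _ _ _ _ c2
      (Cmod_mult_minus_1 _ _ _ _ d1 (Cmod_mult_minus_1 _ _ _ _ d2 one)))))))).
    match goal with |- (0 < fst (_ / ?x)%C)%R => set (D := x) in * end.
    assert (hD1 : (Cmod (D - 1) < 1)%R) by lra. clear hD one a1 a2 b1 b2 c1 c2 d1 d2.
    clearbody D.
    assert (hDpos : (0 < fst D)%R).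
    { generalize (re_le_Cmod (D - 1)). unfold Re; simpl. intros h.
      assert (h' : (Rabs (fst D + - (1)) < 1)%R) by lra. apply Rabs_def2 in h'. lra. }
    assert (hnz : qpoch_inf (cis t ^ 2) q <> 0).
    (* The factor 1 - z^2 vanishes only at z = 1 and z = -1, excluded because sin t > 0 on the open
       interval; the later factors are 1 - q^j z^2 with j > 0. *)
    { apply (qpoch_inf_nz q hq). intros [|j].
      - simpl. intros e.
        assert (e1 : cis t * cis t = 1).
        { rewrite <- (Cplus_0_r (cis t * cis t)), <- e. ring. }
        apply (f_equal fst) in e1. unfold cis in e1; simpl in e1.
        assert (hs := sin_gt_0 t (proj1 ht) (proj2 ht)).
        generalize (sin2_cos2 t). unfold Rsqr. nra.
      - apply Cmod_lt_1_nz. rewrite Cmod_mult_qpow, Cmod_pow, Cmod_cis, pow1, Rmult_1_l by exact hq.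
        simpl. generalize (qpow_le_1 q hq j). nra. }
    (* The numerator is |(z^2;q)_oo|^2, so the real part of the integrand is a positive multiple of
       Re D / |D|^2. *)
    assert (hconj : qpoch_inf (/ cis t ^ 2) q = Cconj (qpoch_inf (cis t ^ 2) q)).
    { rewrite <- (qpoch_inf_conj q hq), Cpow_conj, cis_conj, <- cis_inv.
      f_equal. field. apply cis_nz. }
    rewrite hconj, Cmult_1_r, <- Cmod2_conj.
    apply Cmod_gt_0 in hnz. set (M := Cmod (qpoch_inf (cis t ^ 2) q)) in *. clearbody M.
    unfold Cdiv, Cinv, Cmult; simpl.
    set (x := fst D) in *. set (y := snd D).
    replace (M * (M * 1) * (x / (x * (x * 1) + y * (y * 1)))
      - 0 * (- y / (x * (x * 1) + y * (y * 1))))%R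
      with (M * M * x / (x * x + y * y))%R by (field; nra).
    apply Rdiv_lt_0_compat; [|nra]. repeat apply Rmult_lt_0_compat; assumption.
  - intros t _.
    apply (proj1 (Ccontinuous_mult _ _ t (Ccontinuous_const 1 t)
      (weight_cis_continuous _ _ _ _ (near a ha) (near b hb) (near c hc) (near d hd) t))).
Qed.

End WeightIntegral.

(** * A terminating q-difference operator *)

Lemma sum_n_C_S (u : nat -> C) (n : nat) : sum_n u (S n) = sum_n u n + u (S n).
Proof. exact (sum_Sn u n). Qed.

Lemma sum_n_C_0 (u : nat -> C) : sum_n u 0 = u O.
Proof. exact (sum_O u). Qed.

Lemma Cinv_nz (x : C) : x <> 0 -> / x <> 0.
Proof.
  intros h e. apply C1_nz. rewrite <- (Cinv_r x h), e. ring.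
Qed.

Section QDifference.

Context (q : R) (hq : (0 < q < 1)%R).

Let hq0 := q_nz q hq.

(* With [E f j = f (S j)] this is the operator [(1 - E)(1 - E/q) ... (1 - E/q^(m-1))] at 0. *)
Fixpoint qdiff (m : nat) (f : nat -> C) : C :=
  match m with
  | O => f O
  | S m' => qdiff m' f - / RtoC q ^ m' * qdiff m' (fun j => f (S j))
  end.

Lemma qdiff_ext (m : nat) (f g : nat -> C) : (forall j, f j = g j) -> qdiff m f = qdiff m g.
Proof.
  revert f g. induction m; simpl; intros f g h; [apply h|].
  rewrite (IHm f g h), (IHm (fun j => f (S j)) (fun j => g (S j))); auto.
Qed.

Lemma qdiff_plus (m : nat) (f g : nat -> C) :
  qdiff m (fun j => f j + g j) = qdiff m f + qdiff m g.
Proof.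
  revert f g. induction m; simpl; intros f g; [reflexivity|].
  rewrite IHm, (IHm (fun j => f (S j))). ring.
Qed.

Lemma qdiff_scal (m : nat) (k : C) (f : nat -> C) :
  qdiff m (fun j => k * f j) = k * qdiff m f.
Proof.
  revert f. induction m; simpl; intros f; [reflexivity|].
  rewrite IHm, (IHm (fun j => f (S j))). ring.
Qed.

(** The sequence q^(js) is an eigenvector of E with eigenvalue q^s, so the factor 1 - E/q^s, present
    when s < m, annihilates it. *)
Lemma qdiff_monomial (m s : nat) : (s < m)%nat -> qdiff m (fun j => (RtoC q ^ j) ^ s) = 0.
Proof.
  induction m; intros h; [lia|]. simpl.
  rewrite (qdiff_ext m (fun j => (RtoC q * RtoC q ^ j) ^ s)
    (fun j => RtoC q ^ s * (RtoC q ^ j) ^ s)), qdiff_scal by (intros j; apply Cpow_mult_l).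
  destruct (Nat.eq_dec s m) as [->|hs].
  - field. now apply Cpow_nz.
  - rewrite IHm by lia. ring.
Qed.

(* [f j] is a polynomial of degree less than [n] in [q^j]. *)
Fixpoint qpoly (n : nat) (f : nat -> C) : Prop :=
  match n with
  | O => forall j, f j = 0
  | S n' => exists u g, qpoly n' g /\ forall j, f j = u + RtoC q ^ j * g j
  end.

Lemma qpoly_ext (n : nat) (f g : nat -> C) : (forall j, f j = g j) -> qpoly n f -> qpoly n g.
Proof.
  intros h. destruct n; simpl.
  - intros hf j. now rewrite <- h.
  - intros (u & k & hk & e). exists u, k. split; [exact hk|]. intros j. now rewrite <- h.
Qed.

(** The extra power s makes the induction work: splitting off the constant coefficient of f leaves
    q^j g, which raises s by one while the degree bound drops by one. *)
Lemma qdiff_qpoly_shift (n s m : nat) (f : nat -> C) : qpoly n f -> (s + n <= m)%nat ->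
  qdiff m (fun j => (RtoC q ^ j) ^ s * f j) = 0.
Proof.
  revert s f. induction n; intros s f hf hm; simpl in hf.
  - rewrite (qdiff_ext m _ (fun j => 0 * f j)), qdiff_scal; [ring|].
    intros j. rewrite hf. ring.
  - destruct hf as (u & g & hg & e).
    rewrite (qdiff_ext m _ (fun j => u * (RtoC q ^ j) ^ s + (RtoC q ^ j) ^ (S s) * g j)).
    + rewrite qdiff_plus, qdiff_scal, qdiff_monomial, (IHn (S s) g hg) by lia. ring.
    + intros j. rewrite e, Cpow_S. ring.
Qed.

Lemma qdiff_qpoly (m : nat) (f : nat -> C) : qpoly m f -> qdiff m f = 0.
Proof.
  intros hf. rewrite <- (qdiff_qpoly_shift m 0 m f hf (le_n m)).
  apply qdiff_ext. intros j. simpl. ring.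
Qed.

(** The constant [v] strengthens the induction: for f = w + q^j g the result has constant term w +
    v, and the cofactor of q^j has the same form with constant - u w. *)
Lemma qpoly_mult_linear (n : nat) (f : nat -> C) (u v : C) : qpoly n f ->
  qpoly (S n) (fun j => (1 - u * RtoC q ^ j) * f j + v).
Proof.
  revert f v. induction n; intros f v hf.
  - exists v, (fun _ => 0). split; [simpl; auto|]. simpl in hf. intros j. rewrite hf. ring.
  - destruct hf as (w & g & hg & e).
    exists (w + v), (fun j => (1 - u * RtoC q ^ j) * g j + - (u * w)).
    split; [apply IHn, hg|]. intros j. rewrite e. ring.
Qed.

Lemma qpoly_mult_qpoch (n l : nat) (f : nat -> C) (u : C) : qpoly n f ->
  qpoly (l + n) (fun j => qpoch (u * RtoC q ^ j) q l * f j).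
Proof.
  intros hf. induction l; simpl Nat.add.
  - apply (qpoly_ext n f); [|exact hf]. intros j. simpl. ring.
  - eapply qpoly_ext; [|apply (qpoly_mult_linear _ _ (u * RtoC q ^ l) 0 IHl)].
    intros j. simpl. ring.
Qed.

Lemma qpoly_1 : qpoly 1 (fun _ => 1).
Proof. exists 1, (fun _ => 0). split; [simpl; auto|]. intros j. ring. Qed.

Lemma qpoch_q_nz (n : nat) : qpoch (RtoC q) q n <> 0.
Proof.
  apply (qpoch_nz_lt_1 q hq). rewrite Cmod_R, Rabs_pos_eq; lra.
Qed.

(** Pascal's rule for the coefficients of the operator, from multiplication by one more factor 1 -
    E/q^m. *)
Lemma qdiff_weight_S (m i : nat) :
  qpoch (/ RtoC q ^ S m) q (S i) / qpoch (RtoC q) q (S i) * RtoC q ^ (S i)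
  = qpoch (/ RtoC q ^ m) q (S i) / qpoch (RtoC q) q (S i) * RtoC q ^ (S i)
    - / RtoC q ^ m * (qpoch (/ RtoC q ^ m) q i / qpoch (RtoC q) q i * RtoC q ^ i).
Proof.
  assert (h1 := qpoch_q_nz i). assert (h2 := qpoch_q_nz (S i)).
  assert (hm := Cpow_nz _ m hq0).
  rewrite (qpoch_S_l q (/ RtoC q ^ S m)).
  replace (/ RtoC q ^ S m * RtoC q) with (/ RtoC q ^ m)
    by (rewrite Cpow_S; field; auto).
  simpl in *.
  assert (h3 : 1 - RtoC q * RtoC q ^ i <> 0) by (intros e; apply h2; rewrite e; ring).
  set (Qi := RtoC q ^ i) in *. set (Qm := RtoC q ^ m) in *.
  field. repeat split; assumption.
Qed.

(** The q-binomial theorem: (q^-m;q)_j q^j / (q;q)_j is the coefficient of E^j in the product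
    defining [qdiff]. Terms with j > m vanish, and the free upper bound [N] lets the induction pass
    to the shifted sum, which has one term fewer. *)
Lemma sum_n_qdiff (m N : nat) (f : nat -> C) : (m <= N)%nat ->
  sum_n (fun j => qpoch (/ RtoC q ^ m) q j / qpoch (RtoC q) q j * RtoC q ^ j * f j) N
  = qdiff m f.
Proof.
  revert N f. induction m; intros N f hN.
  - simpl. induction N.
    + rewrite sum_n_C_0. simpl. field.
    + rewrite sum_n_C_S, IHN by lia.
      assert (h : qpoch (/ 1) q (S N) = 0).
      { rewrite qpoch_S_l. field_simplify. ring. }
      rewrite h. unfold Cdiv. ring.
  - simpl qdiff. rewrite <- (IHm N f), <- (IHm (pred N) (fun j => f (S j))) by lia.
    destruct N as [|N]; [lia|]. simpl pred. clear hN.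
    induction N.
    + rewrite !sum_n_C_S, !sum_n_C_0, qdiff_weight_S. simpl. field.
      split; [now apply Cpow_nz|]. assert (h := qpoch_q_nz 1). simpl in h.
      intros e. apply h. rewrite <- e. ring.
    + rewrite sum_n_C_S, IHN, !sum_n_C_S, qdiff_weight_S. C_eq. ring.
Qed.

(** Polynomial division in q^j: 1 - B q^(m+j) is (B q^m / A)(1 - A q^j) plus the remainder 1 - B q^m
    / A. The quotient contributes a polynomial of degree at most m, killed by the operator of order
    m + 1; the remainder leaves order m at the parameters A, B and Aq, Bq. *)
Lemma qdiff_qpoch_div (m : nat) (A B : C) : A <> 0 ->
  (forall j, 1 - A * RtoC q ^ j <> 0) ->
  qdiff m (fun j => qpoch (B * RtoC q ^ j) q m / (1 - A * RtoC q ^ j))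
  = qpoch (B / A) q m * qpoch (RtoC q) q m * A ^ m / qpoch A q (S m).
Proof.
  intros hA hAj. revert A B hA hAj. induction m; intros A B hA hAj.
  - simpl. field. specialize (hAj O). simpl in hAj. rewrite Cmult_1_r in hAj. exact hAj.
  - set (g := fun j => qpoch (B * RtoC q ^ j) q m / (1 - A * RtoC q ^ j)).
    rewrite (qdiff_ext _ _ (fun j => B * RtoC q ^ m / A * (qpoch (B * RtoC q ^ j) q m * 1)
        + (1 - B / A * RtoC q ^ m) * g j)).
    2:{ intros j. unfold g. simpl. field. split; [apply hAj|exact hA]. }
    rewrite qdiff_plus, !qdiff_scal.
    rewrite (qdiff_qpoly (S m) (fun j => qpoch (B * RtoC q ^ j) q m * 1)).
    2:{ replace (S m) with (m + 1)%nat by lia. apply qpoly_mult_qpoch, qpoly_1. }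
    assert (hA' : forall j, 1 - A * RtoC q * RtoC q ^ j <> 0).
    { intros j. specialize (hAj (S j)). rewrite Cpow_S, Cmult_assoc in hAj. exact hAj. }
    simpl qdiff. unfold g at 1. rewrite (IHm A B hA hAj).
    rewrite (qdiff_ext m (fun j => g (S j))
      (fun j => qpoch (B * RtoC q * RtoC q ^ j) q m / (1 - A * RtoC q * RtoC q ^ j))).
    2:{ intros j. unfold g. now rewrite Cpow_S, !Cmult_assoc. }
    rewrite (IHm (A * RtoC q) (B * RtoC q)) by auto using Cmult_neq_0.
    replace (B * RtoC q / (A * RtoC q)) with (B / A) by (field; auto).
    assert (hT : qpoch (A * RtoC q) q m <> 0) by (apply qpoch_nz; auto).
    rewrite !(qpoch_S_l q A). simpl. rewrite Cpow_mult_l.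
    assert (hm := Cpow_nz _ m hq0).
    assert (h1 := hAj O). simpl in h1. rewrite Cmult_1_r in h1.
    assert (h2 := hA' m).
    set (T := qpoch (A * RtoC q) q m) in *. set (Qm := RtoC q ^ m) in *.
    set (Am := A ^ m). field. repeat split; assumption.
Qed.

(** Both sides are (c;q)_(j+l). Read as a quotient, the identity turns (c q^l;q)_j / (c;q)_j into a
    polynomial of degree at most l in q^j. *)
Lemma qpoch_swap (c : C) (j l : nat) :
  qpoch c q j * qpoch (c * RtoC q ^ j) q l = qpoch c q l * qpoch (c * RtoC q ^ l) q j.
Proof. rewrite <- !qpoch_add. f_equal. lia. Qed.

(** By [qpoch_swap] the two quotients are polynomials in q^j of degrees at most l and m - 1 - l, so
    their product has degree below m. *)
Lemma saalschutz_zero (A B : C) (l m : nat) :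
  (Cmod A < 1)%R -> (Cmod B < 1)%R -> (l < m)%nat ->
  qdiff m (fun j => qpoch (A * (RtoC q ^ m / RtoC q)) q j * qpoch (B * RtoC q ^ l) q j
    / (qpoch B q j * qpoch (A * RtoC q ^ l) q j)) = 0.
Proof.
  intros hA hB hl.
  destruct m as [|m]; [lia|].
  replace (RtoC q ^ S m / RtoC q) with (RtoC q ^ m) by (rewrite Cpow_S; field; auto).
  (* [m] now denotes the old m - 1, so r is the old m - 1 - l and the subtraction is exact. *)
  set (r := (m - l)%nat).
  assert (hAl := Cmod_mult_qpow_lt_1 q hq A l hA).
  rewrite (qdiff_ext _ _ (fun j => / (qpoch B q l * qpoch (A * RtoC q ^ l) q r) *
    (qpoch (B * RtoC q ^ j) q l * (qpoch (A * RtoC q ^ l * RtoC q ^ j) q r * 1)))).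
  - rewrite qdiff_scal, qdiff_qpoly; [ring|].
    replace (S m) with (l + (r + 1))%nat by (unfold r; lia).
    apply qpoly_mult_qpoch, qpoly_mult_qpoch, qpoly_1.
  - intros j. assert (e1 := qpoch_swap B j l). assert (e2 := qpoch_swap (A * RtoC q ^ l) j r).
    replace (A * RtoC q ^ l * RtoC q ^ r) with (A * RtoC q ^ m) in e2.
    2:{ rewrite <- Cmult_assoc, <- Cpow_add_r. do 2 f_equal. unfold r. lia. }
    assert (n1 := qpoch_nz_lt_1 q hq B j hB). assert (n2 := qpoch_nz_lt_1 q hq B l hB).
    assert (n3 := qpoch_nz_lt_1 q hq _ j hAl). assert (n4 := qpoch_nz_lt_1 q hq _ r hAl).
    set (x1 := qpoch B q j) in *. set (x2 := qpoch B q l) in *.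
    set (x3 := qpoch (A * RtoC q ^ l) q j) in *. set (x4 := qpoch (A * RtoC q ^ l) q r) in *.
    set (y1 := qpoch (B * RtoC q ^ l) q j) in *. set (y2 := qpoch (B * RtoC q ^ j) q l) in *.
    set (y3 := qpoch (A * RtoC q ^ m) q j) in *.
    set (y4 := qpoch (A * RtoC q ^ l * RtoC q ^ j) q r) in *.
    transitivity ((x2 * y1) * (x4 * y3) / (x1 * x2 * x3 * x4)); [field; repeat split; assumption|].
    rewrite <- e1, <- e2. field. repeat split; assumption.
Qed.

(** For m > 0 the quotient whose degree would be m - 1 - l = -1 is (A;q)_j / (Aq;q)_j = (1 - A)/(1 -
    A q^j) with A = B E q^(m-1). This is a single pole, and [qdiff_qpoch_div] gives a product whose
    factors can be inspected one by one. *)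
Lemma saalschutz_nz (B E : C) (m : nat) : B <> 0 -> E <> 0 ->
  (Cmod B < 1)%R -> (Cmod E < 1)%R ->
  qdiff m (fun j => qpoch (B * E * (RtoC q ^ m / RtoC q)) q j * qpoch (B * RtoC q ^ m) q j
    / (qpoch B q j * qpoch (B * E * RtoC q ^ m) q j)) <> 0.
Proof.
  intros hB0 hE0 hB hE.
  assert (hBE : (Cmod (B * E) < 1)%R).
  { rewrite Cmod_mult. generalize (Cmod_ge_0 B) (Cmod_ge_0 E). nra. }
  destruct m as [|m].
  (* The case m = 0 is separate because q^m / q is then not a natural power of q. *)
  - simpl. replace (1 * 1 / (1 * 1)) with (RtoC 1) by field. apply C1_nz.
  - replace (RtoC q ^ S m / RtoC q) with (RtoC q ^ m) by (rewrite Cpow_S; field; auto).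
    set (A := B * E * RtoC q ^ m).
    replace (B * E * RtoC q ^ S m) with (A * RtoC q) by (unfold A; rewrite Cpow_S; ring).
    assert (hm := Cpow_nz _ m hq0).
    assert (hA0 : A <> 0) by (unfold A; auto using Cmult_neq_0).
    assert (hA : (Cmod A < 1)%R) by (apply Cmod_mult_qpow_lt_1; assumption).
    assert (hAq : (Cmod (A * RtoC q) < 1)%R).
    { generalize (Cmod_mult_qpow_lt_1 q hq A 1 hA). now rewrite Cpow_1_r. }
    assert (hAj : forall j, 1 - A * RtoC q ^ j <> 0)
      by (intros j; apply Cmod_lt_1_nz, Cmod_mult_qpow_lt_1; assumption).
    assert (h1 := Cmod_lt_1_nz A hA).
    assert (n2 := qpoch_nz_lt_1 q hq B (S m) hB).
    rewrite (qdiff_ext _ _ (fun j => (1 - A) / qpoch B q (S m) *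
      (qpoch (B * RtoC q ^ j) q (S m) / (1 - A * RtoC q ^ j)))).
    + assert (k1 : qpoch (B / A) q (S m) <> 0).
      (* B / A is 1/(E q^m), so each factor is 1 - 1/(E q^(m-j)) with |E q^(m-j)| < 1. *)
      { apply qpoch_nz. intros j hj.
        replace (B / A * RtoC q ^ j) with (/ (E * RtoC q ^ (m - j))).
        -- intros e.
           assert (hx : (Cmod (E * RtoC q ^ (m - j)) < 1)%R)
             by (apply Cmod_mult_qpow_lt_1; assumption).
           apply Cmod_lt_1_nz in hx. apply hx.
           assert (hn : E * RtoC q ^ (m - j) <> 0) by auto using Cmult_neq_0, Cpow_nz.
           replace (1 - E * RtoC q ^ (m - j))
             with (- (E * RtoC q ^ (m - j)) * (1 - / (E * RtoC q ^ (m - j))))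
             by (field; auto using Cpow_nz).
           rewrite e. ring.
        -- unfold A.
           replace (RtoC q ^ m) with (RtoC q ^ (m - j) * RtoC q ^ j)
             by (rewrite <- Cpow_add_r; f_equal; lia).
           assert (k1 := Cpow_nz _ (m - j) hq0). assert (k2 := Cpow_nz _ j hq0).
           field. repeat split; assumption. }
      assert (k2 := qpoch_q_nz (S m)). assert (k3 := Cpow_nz A (S m) hA0).
      assert (k4 := qpoch_nz_lt_1 q hq A (S (S m)) hA).
      rewrite qdiff_scal, qdiff_qpoch_div by auto.
      set (x1 := qpoch (B / A) q (S m)) in *. set (x2 := qpoch (RtoC q) q (S m)) in *.
      set (x3 := A ^ S m) in *. set (x4 := qpoch A q (S (S m))) in *.
      set (x5 := qpoch B q (S m)) in *. clearbody x1 x2 x3 x4 x5. clear - h1 n2 k1 k2 k3 k4.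
      unfold Cdiv. repeat apply Cmult_neq_0; auto using Cinv_nz.
    + intros j. assert (e1 := qpoch_swap B j (S m)).
      assert (e2 : qpoch A q j * (1 - A * RtoC q ^ j) = (1 - A) * qpoch (A * RtoC q) q j).
      { rewrite <- qpoch_S_l. reflexivity. }
      assert (n1 := qpoch_nz_lt_1 q hq B j hB). assert (n3 := qpoch_nz_lt_1 q hq _ j hAq).
      specialize (hAj j).
      set (x1 := qpoch B q j) in *. set (x2 := qpoch B q (S m)) in *.
      set (x3 := qpoch (A * RtoC q) q j) in *. set (x4 := qpoch A q j) in *.
      set (y1 := qpoch (B * RtoC q ^ S m) q j) in *.
      set (y2 := qpoch (B * RtoC q ^ j) q (S m)) in *. set (w := 1 - A * RtoC q ^ j) in *.
      transitivity ((x4 * w) * (x2 * y1) / (x1 * x2 * x3 * w)); [field; repeat split; assumption|].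
      rewrite e2, <- e1. field. repeat split; assumption.
Qed.

End QDifference.

(** * Polynomials in x and the Askey-Wilson pairing *)

(* [f] is a polynomial of degree less than [n] on [-1, 1]. *)
Fixpoint xpoly (n : nat) (f : R -> C) : Prop :=
  match n with
  | O => forall x, (-1 <= x <= 1)%R -> f x = 0
  | S n' => exists u g, xpoly n' g /\
      forall x, (-1 <= x <= 1)%R -> f x = g x + u * RtoC x ^ n'
  end.

Definition xlead (n : nat) (u : C) (f : R -> C) : Prop :=
  exists g, xpoly n g /\ forall x, (-1 <= x <= 1)%R -> f x = g x + u * RtoC x ^ n.

Lemma xlead_xpoly (n : nat) (u : C) (f : R -> C) : xlead n u f -> xpoly (S n) f.
Proof. intros h. now exists u. Qed.

Lemma xpoly_ext (n : nat) (f g : R -> C) :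
  (forall x, (-1 <= x <= 1)%R -> f x = g x) -> xpoly n f -> xpoly n g.
Proof.
  intros h. destruct n; simpl.
  - intros hf x hx. rewrite <- h; auto.
  - intros (u & k & hk & e). exists u, k. split; [exact hk|].
    intros x hx. rewrite <- h; auto.
Qed.

Lemma xlead_ext (n : nat) (u : C) (f g : R -> C) :
  (forall x, (-1 <= x <= 1)%R -> f x = g x) -> xlead n u f -> xlead n u g.
Proof.
  intros h (k & hk & e). exists k. split; [exact hk|]. intros x hx. rewrite <- h; auto.
Qed.

Lemma xpoly_plus (n : nat) (f g : R -> C) :
  xpoly n f -> xpoly n g -> xpoly n (fun x => f x + g x).
Proof.
  revert f g. induction n; simpl; intros f g hf hg.
  - intros x hx. rewrite hf, hg by exact hx. ring.
  - destruct hf as (u & f' & hf & ef), hg as (v & g' & hg & eg).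
    exists (u + v), (fun x => f' x + g' x). split; [auto|].
    intros x hx. rewrite ef, eg by exact hx. ring.
Qed.

Lemma xpoly_scal (n : nat) (k : C) (f : R -> C) : xpoly n f -> xpoly n (fun x => k * f x).
Proof.
  revert f. induction n; simpl; intros f hf.
  - intros x hx. rewrite hf by exact hx. ring.
  - destruct hf as (u & f' & hf & ef). exists (k * u), (fun x => k * f' x).
    split; [auto|]. intros x hx. rewrite ef by exact hx. ring.
Qed.

Lemma xpoly_S (n : nat) (f : R -> C) : xpoly n f -> xpoly (S n) f.
Proof.
  intros hf. exists 0, f. split; [exact hf|]. intros x _. ring.
Qed.

Lemma xpoly_le (n m : nat) (f : R -> C) : (n <= m)%nat -> xpoly n f -> xpoly m f.
Proof. induction 1; auto using xpoly_S. Qed.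

Lemma xpoly_0 (n : nat) : xpoly n (fun _ => 0).
Proof. apply (xpoly_le 0); [lia|]. simpl. auto. Qed.

Lemma xlead_linear (n : nat) (u s t : C) (f : R -> C) : xlead n u f ->
  xlead (S n) (t * u) (fun x => (s + t * RtoC x) * f x).
Proof.
  revert u f. induction n; intros u f (g & hg & e).
  - exists (fun x => 0 + s * u * RtoC x ^ 0). split.
    + exists (s * u), (fun _ => 0). split; [apply xpoly_0|reflexivity].
    + intros x hx. rewrite e, hg by exact hx. simpl. ring.
  - exists (fun x => (s + t * RtoC x) * g x + s * u * RtoC x ^ S n). split.
    + apply xpoly_plus.
      * destruct hg as (v & hv). now apply (xlead_xpoly _ (t * v)), IHn.
      * exists (s * u), (fun _ => 0). split; [apply xpoly_0|]. intros; ring.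
    + intros x hx. rewrite e, (Cpow_S _ (S n)) by exact hx. ring.
Qed.

Lemma xpoly_continuous (n : nat) (f : R -> C) (t : R) : xpoly n f ->
  Ccontinuous (fun s => f (cos s)) t.
Proof.
  revert f. induction n; simpl; intros f hf.
  - apply (Ccontinuous_ext (fun _ => 0)); [|apply Ccontinuous_const].
    intros s. symmetry. apply hf, COS_bound.
  - destruct hf as (u & g & hg & e).
    apply (Ccontinuous_ext (fun s => g (cos s) + u * RtoC (cos s) ^ n)).
    { intros s. symmetry. apply e, COS_bound. }
    apply Ccontinuous_plus; [auto|]. apply Ccontinuous_mult; [apply Ccontinuous_const|].
    assert (h : Ccontinuous (fun s => RtoC (cos s)) t)
      by (split; [apply continuous_cos|apply continuous_const]).
    clear - h. induction n; simpl; [apply Ccontinuous_const|now apply Ccontinuous_mult].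
Qed.

Lemma xpoly_reduce (n : nat) (u : C) (e f : R -> C) : u <> 0 -> xlead n u e ->
  xpoly (S n) f -> exists k g, xpoly n g /\
    forall x, (-1 <= x <= 1)%R -> f x = g x + k * e x.
Proof.
  intros hu (r & hr & er) (v & g & hg & ef).
  exists (v / u), (fun x => g x + (- (v / u)) * r x).
  split; [apply xpoly_plus; [exact hg|now apply xpoly_scal]|].
  intros x hx. rewrite er, ef by exact hx. field. exact hu.
Qed.

(** Triangularity: subtracting the multiple of the last basis element with the same leading
    coefficient lowers the degree. This provides the existence of the expansion. *)
Lemma xpoly_basis (e : nat -> R -> C) (n : nat) (f : R -> C) :
  (forall j, (j <= n)%nat -> exists u : C, u <> 0 /\ xlead j u (e j)) -> xpoly (S n) f ->
  exists c : nat -> C, forall x, (-1 <= x <= 1)%R -> f x = sum_n (fun j => c j * e j x) n.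
Proof.
  revert f. induction n; intros f he hf.
  - destruct (he O (le_n _)) as (u & hu & hl).
    destruct (xpoly_reduce _ _ _ _ hu hl hf) as (k & g & hg & eg).
    exists (fun _ => k). intros x hx. rewrite sum_n_C_0, eg, hg by exact hx. ring.
  - destruct (he (S n) (le_n _)) as (u & hu & hl).
    destruct (xpoly_reduce _ _ _ _ hu hl hf) as (k & g & hg & eg).
    destruct (IHn g) as [c hc]; [intros; apply he; lia|exact hg|].
    exists (fun j => if Nat.eq_dec j (S n) then k else c j). intros x hx.
    rewrite sum_n_C_S, eg, hc by exact hx.
    destruct (Nat.eq_dec (S n) (S n)); [|lia].
    apply (f_equal (fun s : C => s + k * e (S n) x)). apply (sum_n_ext_loc (G := C_AbelianMonoid)). intros j hj.
    destruct (Nat.eq_dec j (S n)); [lia|reflexivity].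
Qed.

Lemma sum_n_C_scal (k : C) (u : nat -> C) (n : nat) :
  sum_n (fun j => k * u j) n = k * sum_n u n.
Proof. exact (sum_n_mult_l (K := C_Ring) k u n). Qed.

Lemma sum_n_C_single (u : nat -> C) (m n : nat) : (m <= n)%nat ->
  (forall j, (j <= n)%nat -> j <> m -> u j = 0) -> sum_n u n = u m.
Proof.
  intros hm h. induction n.
  - replace m with O by lia. apply sum_n_C_0.
  - rewrite sum_n_C_S. destruct (Nat.eq_dec m (S n)) as [->|hne].
    + replace (sum_n u n) with (RtoC 0); [C_eq; ring|]. symmetry. clear IHn hm.
      assert (h' : forall j, (j <= n)%nat -> u j = 0) by (intros; apply h; lia). clear h.
      induction n; [rewrite sum_n_C_0; auto|].
      rewrite sum_n_C_S, h', IHn by auto. C_eq. ring.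
    + rewrite IHn, (h (S n)) by (intros; try apply h; lia). C_eq. ring.
Qed.

Lemma zof_nz (x : R) : zof x <> 0.
Proof. apply (cis_nz (acos x)). Qed.

Lemma zof_plus_inv (x : R) : (-1 <= x <= 1)%R -> zof x + / zof x = 2 * RtoC x.
Proof.
  intros hx. change (zof x) with (cis (acos x)). rewrite cis_inv.
  unfold cis. rewrite cos_neg, sin_neg, cos_acos by exact hx.
  apply injective_projections; simpl; ring.
Qed.

(** * Shifted weights, pairings and orthogonality *)

Section Bernstein.

Context (q : R) (hq : (0 < q < 1)%R).

(** The two new factors combine to 1 + A^2 - 2 A x with A = a q^k, of exact degree one in x when a
    is nonzero. *)
Lemma phi_S (k : nat) (a : C) (x : R) : (-1 <= x <= 1)%R ->
  phi q (S k) a x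
  = (1 + (a * RtoC q ^ k) ^ 2 + (- (2) * (a * RtoC q ^ k)) * RtoC x) * phi q k a x.
Proof.
  intros hx. unfold phi, qpochs, Cprod; simpl.
  set (Q := RtoC q ^ k). set (z := zof x).
  transitivity ((1 + a * Q * (a * Q) - a * Q * (z + / z)) *
    (qpoch (a * z) q k * (qpoch (a / z) q k * 1))).
  - field. apply zof_nz.
  - unfold z. rewrite zof_plus_inv by exact hx. ring.
Qed.

Lemma xlead_phi_mult (k n : nat) (a u : C) (f : R -> C) : a <> 0 -> u <> 0 -> xlead n u f ->
  exists v : C, v <> 0 /\ xlead (k + n) v (fun x => phi q k a x * f x).
Proof.
  intros ha hu hf. induction k.
  - exists u. split; [exact hu|]. apply (xlead_ext _ _ f); [|exact hf].
    intros x _. unfold phi, qpochs, Cprod; simpl. ring.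
  - destruct IHk as (v & hv & hl). eexists. split.
    2:{ eapply xlead_ext; [|exact (xlead_linear _ _ (1 + (a * RtoC q ^ k) ^ 2)
          (- (2) * (a * RtoC q ^ k)) _ hl)].
        intros x hx. cbv beta. rewrite phi_S by exact hx. ring. }
    assert (hq0 := q_nz q hq).
    assert (h2 : - (2) <> 0) by (intros e; apply (f_equal fst) in e; simpl in e; lra).
    repeat apply Cmult_neq_0; auto using Cpow_nz.
Qed.

Lemma xlead_phi (k : nat) (a : C) : a <> 0 -> exists v : C, v <> 0 /\ xlead k v (phi q k a).
Proof.
  intros ha. destruct (xlead_phi_mult k 0 a 1 (fun _ => 1) ha C1_nz) as (v & hv & hl).
  - exists (fun _ => 0). split; [apply xpoly_0|]. intros; simpl; ring.
  - exists v. split; [exact hv|]. rewrite Nat.add_0_r in hl.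
    eapply xlead_ext; [|exact hl]. intros; simpl; ring.
Qed.

Lemma xpoly_bernstein (n k : nat) (a b : C) : a <> 0 -> b <> 0 -> (k <= n)%nat ->
  xpoly (S n) (bernstein q n k a b).
Proof.
  intros ha hb hk. destruct (xlead_phi (n - k) b hb) as (u & hu & hl).
  destruct (xlead_phi_mult k _ a u _ ha hu hl) as (v & hv & hl').
  replace (k + (n - k))%nat with n in hl' by lia.
  apply (xpoly_ext _ (fun x => RtoC (Binomial.C n k) * (phi q k a x * phi q (n - k) b x))).
  - intros x _. unfold bernstein. ring.
  - apply xpoly_scal. exact (xlead_xpoly _ _ _ hl').
Qed.

Lemma weight_z_shift (a b c d z : C) (j : nat) :
  (Cmod a < 1)%R -> (Cmod b < 1)%R -> (Cmod c < 1)%R -> (Cmod d < 1)%R -> Cmod z = 1%R ->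
  qpochs [a * z; a / z] q j * weight_z q a b c d z = weight_z q (a * RtoC q ^ j) b c d z.
Proof.
  intros ha hb hc hd hz. unfold qpochs, Cprod. cbn [map fold_right]. induction j.
  - simpl. replace (a * 1) with a by ring. ring.
  - simpl qpoch.
    replace (a * RtoC q ^ S j) with (a * RtoC q ^ j * RtoC q) by (rewrite Cpow_S; ring).
    rewrite weight_z_shift_1, <- IHj by (try apply Cmod_mult_qpow_lt_1; assumption).
    unfold Cdiv. ring.
Qed.

Context (a b c d : C) (ha0 : a <> 0) (hb0 : b <> 0)
  (ha : (Cmod a < 1)%R) (hb : (Cmod b < 1)%R) (hc : (Cmod c < 1)%R) (hd : (Cmod d < 1)%R).

Lemma phi_weight (j l : nat) (t : R) : (0 <= t <= PI)%R ->
  phi q j a (cos t) * phi q l b (cos t) * weight_z q a b c d (cis t)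
  = weight_z q (a * RtoC q ^ j) (b * RtoC q ^ l) c d (cis t).
Proof.
  intros ht. unfold phi. rewrite zof_cos by exact ht.
  rewrite (weight_z_swap q a b), <- Cmult_assoc, weight_z_shift by auto using Cmod_cis.
  rewrite (weight_z_swap q _ a), weight_z_shift
    by (try apply Cmod_mult_qpow_lt_1; auto using Cmod_cis).
  reflexivity.
Qed.

Definition pair_int (f g : R -> C) : C := wint q a b c d (fun t => f (cos t) * g (cos t)).

Lemma pair_int_comm (f g : R -> C) : pair_int f g = pair_int g f.
Proof. unfold pair_int. apply wint_ext. intros t _. ring. Qed.

Lemma bilin_pair_int (f g : R -> C) : bilin q a b c d f g = / RtoC (2 * PI) * pair_int f g.
Proof. unfold bilin. rewrite weight_integral_wint. reflexivity. Qed.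

Lemma pair_int_linear (n m : nat) (k : C) (f g h p : R -> C) :
  xpoly n g -> xpoly n h -> xpoly m p ->
  (forall x, (-1 <= x <= 1)%R -> f x = g x + k * h x) ->
  pair_int f p = pair_int g p + k * pair_int h p.
Proof.
  intros hg hh hp e. unfold pair_int.
  assert (cont : forall u, xpoly n u -> forall t, Ccontinuous (fun t => u (cos t) * p (cos t)) t)
    by (intros u hu t; apply Ccontinuous_mult; eapply xpoly_continuous; eassumption).
  rewrite <- wint_scal, <- wint_plus by auto using Ccontinuous_mult, Ccontinuous_const.
  apply wint_ext. intros t _. rewrite e by apply COS_bound. ring.
Qed.

Lemma pair_int_sum (n m : nat) (k : nat -> C) (e : nat -> R -> C) (f p : R -> C) :
  (forall j, (j <= n)%nat -> xpoly (S n) (e j)) -> xpoly m p ->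
  (forall x, (-1 <= x <= 1)%R -> f x = sum_n (fun j => k j * e j x) n) ->
  pair_int f p = sum_n (fun j => k j * pair_int (e j) p) n.
Proof.
  (* The degree bound is decoupled from [n], which decreases in the induction. *)
  intros he hp. set (N := S n) in he. clearbody N.
  revert f. induction n; intros f hf.
  - rewrite sum_n_C_0. assert (he0 := he O (le_n _)).
    rewrite (pair_int_linear N m (k O) f (fun _ => 0) (e O) p); auto using xpoly_0.
    + replace (pair_int (fun _ => 0) p) with (RtoC 0); [ring|].
      (* Linearity applied to 0 = e - e makes the pairing with the zero function vanish. *)
      assert (hz := pair_int_linear N m (- (1)) (fun _ => 0) (e O) (e O) p he0 he0 hp).
      rewrite hz by (intros; ring). ring.
    + intros x hx. rewrite hf, sum_n_C_0 by exact hx. ring.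
  - rewrite sum_n_C_S.
    rewrite (pair_int_linear N m (k (S n)) f (fun x => sum_n (fun j => k j * e j x) n) (e (S n)) p);
      auto.
    + rewrite (IHn (fun j hj => he j (le_S _ _ hj)) (fun x => sum_n (fun j => k j * e j x) n));
        [reflexivity|auto].
    + clear - he. induction n.
      * apply (xpoly_ext _ (fun x => k O * e O x)); [intros; now rewrite sum_n_C_0|].
        apply xpoly_scal; auto.
      * apply (xpoly_ext _ (fun x => sum_n (fun j => k j * e j x) n + k (S n) * e (S n) x));
          [intros; now rewrite sum_n_C_S|].
        apply xpoly_plus; [apply IHn; intros; apply he; lia|apply xpoly_scal, he; lia].
    + intros x hx. now rewrite hf, sum_n_C_S by exact hx.
Qed.

Lemma pair_int_phi (j l : nat) :
  pair_int (phi q j a) (phi q l b) = mass q (a * RtoC q ^ j) (b * RtoC q ^ l) c d.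
Proof.
  unfold pair_int, mass. apply wint_ext. intros t ht. rewrite phi_weight by lra. ring.
Qed.

Definition aw_coef (m j : nat) : C :=
  / a ^ m * qpochs [a * b; a * c; a * d] q m *
  (qpochs [/ RtoC q ^ m; a * b * c * d * (RtoC q ^ m / RtoC q)] q j
   / qpochs [RtoC q; a * b; a * c; a * d] q j * RtoC q ^ j).

Lemma askey_wilson_phi (m : nat) (x : R) :
  askey_wilson q m a b c d x = sum_n (fun j => aw_coef m j * phi q j a x) m.
Proof.
  unfold askey_wilson. rewrite <- sum_n_C_scal. apply (sum_n_ext (G := C_AbelianMonoid)). intros j.
  unfold aw_coef, phi, qpochs, Cprod, Cdiv. cbn [map fold_right]. C_eq. ring.
Qed.

Lemma Cmod_ab_lt_1 : (Cmod (a * b) < 1)%R.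
Proof. now apply Cmod_mult2_lt_1. Qed.

Lemma Cmod_abcd_lt_1 : (Cmod (a * b * c * d) < 1)%R.
Proof. now repeat apply Cmod_mult2_lt_1. Qed.

Lemma aw_coef_lead_nz (m : nat) : aw_coef m m <> 0.
Proof.
  assert (hq0 := q_nz q hq).
  assert (n1 := qpoch_nz_lt_1 q hq (a * b) m (Cmod_mult2_lt_1 a b ha hb)).
  assert (n2 := qpoch_nz_lt_1 q hq (a * c) m (Cmod_mult2_lt_1 a c ha hc)).
  assert (n3 := qpoch_nz_lt_1 q hq (a * d) m (Cmod_mult2_lt_1 a d ha hd)).
  assert (n4 := qpoch_q_nz q hq m). assert (n5 := Cpow_nz a m ha0). assert (n6 := Cpow_nz _ m hq0).
  (* The factors are 1 - q^(j-m) with j < m, none of which is zero. *)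
  assert (n7 : qpoch (/ RtoC q ^ m) q m <> 0).
  { apply qpoch_nz. intros j hj e.
    assert (h : 1 - 1 * RtoC q ^ (m - j) = 0).
    { replace (RtoC q ^ m) with (RtoC q ^ (m - j) * RtoC q ^ j) in e
        by (rewrite <- Cpow_add_r; f_equal; lia).
      assert (k1 := Cpow_nz _ (m - j) hq0). assert (k2 := Cpow_nz _ j hq0).
      transitivity (- RtoC q ^ (m - j) * (1 - / (RtoC q ^ (m - j) * RtoC q ^ j) * RtoC q ^ j));
        [field; auto|]. rewrite e. ring. }
    revert h. apply Cmod_lt_1_nz. rewrite Cmod_mult_qpow, Cmod_1 by exact hq.
    destruct (m - j)%nat as [|i] eqn:E; [lia|]. simpl. generalize (qpow_le_1 q hq i). nra. }
  assert (n8 : qpoch (a * b * c * d * (RtoC q ^ m / RtoC q)) q m <> 0).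
  (* For m = 0 the parameter abcd/q may have modulus at least 1, but the product is empty. *)
  { destruct m as [|m]; [apply C1_nz|].
    replace (RtoC q ^ S m / RtoC q) with (RtoC q ^ m) by (rewrite Cpow_S; field; auto).
    apply qpoch_nz_lt_1, Cmod_mult_qpow_lt_1, Cmod_abcd_lt_1; exact hq. }
  unfold aw_coef, qpochs, Cprod, Cdiv in *. cbn [map fold_right].
  repeat apply Cmult_neq_0; auto using C1_nz, Cinv_nz.
  apply Cinv_nz. repeat apply Cmult_neq_0; auto using C1_nz.
Qed.

Lemma xlead_askey_wilson (m : nat) : exists u : C, u <> 0 /\ xlead m u (askey_wilson q m a b c d).
Proof.
  destruct (xlead_phi m a ha0) as (v & hv & g & hg & e).
  exists (aw_coef m m * v). split; [apply Cmult_neq_0; [apply aw_coef_lead_nz|exact hv]|].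
  assert (hs : forall i, xpoly (S i) (fun x => sum_n (fun j => aw_coef m j * phi q j a x) i)).
  { induction i.
    - apply (xpoly_ext _ (fun x => aw_coef m 0 * phi q 0 a x));
        [intros; now rewrite sum_n_C_0|].
      destruct (xlead_phi 0 a ha0) as (w & _ & hw). now apply xpoly_scal, (xlead_xpoly _ w).
    - apply (xpoly_ext _ (fun x => sum_n (fun j => aw_coef m j * phi q j a x) i
        + aw_coef m (S i) * phi q (S i) a x)); [intros; now rewrite sum_n_C_S|].
      apply xpoly_plus; [now apply xpoly_S|].
      destruct (xlead_phi (S i) a ha0) as (w & _ & hw). now apply xpoly_scal, (xlead_xpoly _ w). }
  destruct m as [|m].
  - exists (fun x => aw_coef 0 0 * g x). split; [now apply xpoly_scal|].
    intros x hx. rewrite askey_wilson_phi, sum_n_C_0, e by exact hx. ring.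
  - exists (fun x => sum_n (fun j => aw_coef (S m) j * phi q j a x) m + aw_coef (S m) (S m) * g x).
    split; [apply xpoly_plus; [apply hs|now apply xpoly_scal]|].
    intros x hx. rewrite askey_wilson_phi, sum_n_C_S, e by exact hx. ring.
Qed.

Lemma xpoly_askey_wilson (m : nat) : xpoly (S m) (askey_wilson q m a b c d).
Proof. destruct (xlead_askey_wilson m) as (u & _ & h). exact (xlead_xpoly _ _ _ h). Qed.

(** The j-th term of p_m contributes the mass at a q^j, b q^l, which [mass_shift] expresses through
    the mass at a, b q^l. The factors (ac;q)_j and (ad;q)_j so produced cancel those in the
    denominator of p_m, and the sum over j is [qdiff] applied to the remaining quotient. *)
Lemma pair_int_askey_wilson_phi (m l : nat) :
  pair_int (askey_wilson q m a b c d) (phi q l b)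
  = / a ^ m * qpochs [a * b; a * c; a * d] q m * mass q a (b * RtoC q ^ l) c d *
    qdiff q m (fun j => qpoch (a * b * c * d * (RtoC q ^ m / RtoC q)) q j
                        * qpoch (a * b * RtoC q ^ l) q j
      / (qpoch (a * b) q j * qpoch (a * b * c * d * RtoC q ^ l) q j)).
Proof.
  destruct (xlead_phi l b hb0) as (w & _ & hw).
  rewrite (pair_int_sum m (S l) (aw_coef m) (fun j => phi q j a) _ _); cycle 1.
  { intros j hj. destruct (xlead_phi j a ha0) as (v & _ & hv).
    apply (xpoly_le (S j)); [lia|exact (xlead_xpoly _ _ _ hv)]. }
  { exact (xlead_xpoly _ _ _ hw). }
  { intros x _. apply askey_wilson_phi. }
  rewrite <- (sum_n_qdiff q hq m m) by lia.
  rewrite <- sum_n_C_scal. apply (sum_n_ext (G := C_AbelianMonoid)). intros j.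
  rewrite pair_int_phi.
  assert (hbl := Cmod_mult_qpow_lt_1 q hq b l hb).
  assert (hs := mass_shift q hq a (b * RtoC q ^ l) c d j ha hbl hc hd).
  replace (a * (b * RtoC q ^ l) * c * d) with (a * b * c * d * RtoC q ^ l) in hs by ring.
  replace (a * (b * RtoC q ^ l)) with (a * b * RtoC q ^ l) in hs by ring.
  assert (n0 := qpoch_nz_lt_1 q hq _ j
    (Cmod_mult_qpow_lt_1 q hq (a * b * c * d) l Cmod_abcd_lt_1)).
  assert (n1 := qpoch_nz_lt_1 q hq (a * b) j (Cmod_mult2_lt_1 a b ha hb)).
  assert (n2 := qpoch_nz_lt_1 q hq (a * c) j (Cmod_mult2_lt_1 a c ha hc)).
  assert (n3 := qpoch_nz_lt_1 q hq (a * d) j (Cmod_mult2_lt_1 a d ha hd)).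
  assert (n4 := qpoch_q_nz q hq j).
  set (M := mass q (a * RtoC q ^ j) (b * RtoC q ^ l) c d) in *.
  assert (hM : M = qpoch (a * b * RtoC q ^ l) q j * qpoch (a * c) q j * qpoch (a * d) q j *
    mass q a (b * RtoC q ^ l) c d / qpoch (a * b * c * d * RtoC q ^ l) q j).
  { rewrite <- hs. field. exact n0. }
  rewrite hM. unfold aw_coef, qpochs, Cprod. cbn [map fold_right]. C_eq.
  set (p := / a ^ m).
  field. repeat split; assumption.
Qed.

(** The phi_l(.;b) with l < n span the polynomials of degree below n triangularly, and each pairs to
    zero by [saalschutz_zero] since l < m. *)
Lemma pair_int_askey_wilson_low (n m : nat) (f : R -> C) : (n <= m)%nat -> xpoly n f ->
  pair_int f (askey_wilson q m a b c d) = 0.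
Proof.
  assert (hp := xpoly_askey_wilson m).
  revert f. induction n; intros f hn hf.
  - unfold pair_int. transitivity (wint q a b c d (fun t => 0 * 1)).
    + apply wint_ext. intros t _. rewrite hf by apply COS_bound. ring.
    + rewrite wint_scal by auto using Ccontinuous_const. ring.
  - destruct (xlead_phi n b hb0) as (v & hv & hl).
    destruct (xpoly_reduce _ _ _ _ hv hl hf) as (k & g & hg & e).
    rewrite (pair_int_linear (S n) (S m) k f g (phi q n b)); auto using xpoly_S.
    + rewrite IHn by (auto; lia).
      rewrite (pair_int_comm (phi q n b)), pair_int_askey_wilson_phi.
      rewrite saalschutz_zero by (auto using Cmod_ab_lt_1, Cmod_abcd_lt_1). ring.
    + exact (xlead_xpoly _ _ _ hl).
Qed.

Lemma pair_int_askey_wilson_orthogonal (i m : nat) : i <> m ->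
  pair_int (askey_wilson q i a b c d) (askey_wilson q m a b c d) = 0.
Proof.
  intros him. destruct (Nat.lt_ge_cases i m).
  - apply (pair_int_askey_wilson_low (S i)); [lia|apply xpoly_askey_wilson].
  - rewrite pair_int_comm.
    apply (pair_int_askey_wilson_low (S m)); [lia|apply xpoly_askey_wilson].
Qed.

(** Modulo lower degree, p_m is (u/v) phi_m(.;b), and lower degrees pair to zero. The norm is
    therefore, up to nonzero factors, the sum with l = m, where E = cd has to be nonzero. *)
Lemma pair_int_askey_wilson_nz (hc0 : c <> 0) (hd0 : d <> 0) (m : nat) :
  pair_int (askey_wilson q m a b c d) (askey_wilson q m a b c d) <> 0.
Proof.
  destruct (xlead_askey_wilson m) as (u & hu & g & hg & e).
  destruct (xlead_phi m b hb0) as (v & hv & r & hr & er).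
  rewrite (pair_int_linear (S m) (S m) (u / v) _ (fun x => g x + (- (u / v)) * r x) (phi q m b)).
  - rewrite (pair_int_askey_wilson_low m m)
      by (auto; apply xpoly_plus; auto using xpoly_scal).
    rewrite (pair_int_comm (phi q m b)), pair_int_askey_wilson_phi.
    rewrite Cplus_0_l.
    assert (n1 := saalschutz_nz q hq (a * b) (c * d) m (Cmult_neq_0 _ _ ha0 hb0)
      (Cmult_neq_0 _ _ hc0 hd0) Cmod_ab_lt_1 (Cmod_mult2_lt_1 c d hc hd)).
    replace (a * b * (c * d)) with (a * b * c * d) in n1 by ring.
    assert (n2 := mass_nz q hq a (b * RtoC q ^ m) c d ha (Cmod_mult_qpow_lt_1 q hq b m hb) hc hd).
    unfold qpochs, Cprod, Cdiv at 1. cbn [map fold_right].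
    repeat apply Cmult_neq_0; auto using Cinv_nz, Cpow_nz, C1_nz;
      apply (qpoch_nz_lt_1 q hq); now apply Cmod_mult2_lt_1.
  - apply xpoly_S, xpoly_plus; auto using xpoly_scal.
  - apply (xlead_xpoly _ v). exists r. auto.
  - apply xpoly_askey_wilson.
  - intros x hx. rewrite e, er by exact hx. field. exact hv.
Qed.

End Bernstein.

(** * The moment formula and the connection coefficients *)

Theorem corollary5p2 (q : R) (a b c d : C) (n k m : nat)
    (hq : (0 < q < 1)%R)
    (ha0 : a <> 0) (hb0 : b <> 0) (hc0 : c <> 0) (hd0 : d <> 0)
    (ha : (Cmod a < 1)%R) (hb : (Cmod b < 1)%R)
    (hc : (Cmod c < 1)%R) (hd : (Cmod d < 1)%R)
    (hk : (k <= n)%nat) (hm : (m <= n)%nat) :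
  bilin q a b c d (bernstein q n k a b) (askey_wilson q m a b c d)
    = RtoC (Binomial.C n k) * Jint q a b c d n m k
  /\ (exists Cm : nat -> C, is_bernstein_expansion q a b c d n k Cm)
  /\ hnorm q a b c d m <> 0
  /\ (forall Cm : nat -> C, is_bernstein_expansion q a b c d n k Cm ->
        Cm m = RtoC (Binomial.C n k) / hnorm q a b c d m
               * Jint q a b c d n m k).
Proof.
  assert (hpi : RtoC (2 * PI) <> 0).
  { intros h. apply RtoC_inj in h. generalize PI_RGT_0. lra. }
  assert (moment : bilin q a b c d (bernstein q n k a b) (askey_wilson q m a b c d)
    = RtoC (Binomial.C n k) * Jint q a b c d n m k).
  { rewrite bilin_pair_int. unfold Jint. rewrite weight_integral_wint.
    replace (RtoC (Binomial.C n k) * (/ RtoC (2 * PI) * _)) with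
      (/ RtoC (2 * PI) * (RtoC (Binomial.C n k) * wint q (a * RtoC q ^ k) (b * RtoC q ^ (n - k)) c d
        (fun t => askey_wilson q m a b c d (cos t)))) by ring.
    apply (f_equal (Cmult _)). unfold pair_int. rewrite <- wint_scal.
    (* Read backwards with exponents k and n - k, [phi_weight] restores the original weight under
       the integral. *)
    - apply wint_ext. intros t ht. rewrite <- phi_weight by (auto; lra).
      unfold bernstein. ring.
    - exact hq.
    - now apply Cmod_mult_qpow_lt_1.
    - now apply Cmod_mult_qpow_lt_1.
    - exact hc.
    - exact hd.
    - intros t. apply (xpoly_continuous (S m)). now apply xpoly_askey_wilson. }
  assert (hnz : hnorm q a b c d m <> 0).
  { unfold hnorm. rewrite bilin_pair_int. apply Cmult_neq_0; [now apply Cinv_nz|].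
    now apply pair_int_askey_wilson_nz. }
  split; [exact moment|]. split; [|split; [exact hnz|]].
  - apply (xpoly_basis (fun j => askey_wilson q j a b c d)).
    + intros j _. now apply xlead_askey_wilson.
    + now apply xpoly_bernstein.
  - intros Cm he.
    (* Pairing the expansion with p_m leaves, by orthogonality, the single term with index m. *)
    assert (e : bilin q a b c d (bernstein q n k a b) (askey_wilson q m a b c d)
      = Cm m * hnorm q a b c d m).
    { unfold hnorm. rewrite !bilin_pair_int.
      rewrite (pair_int_sum q hq a b c d ha hb hc hd n (S m) Cm
        (fun j => askey_wilson q j a b c d) (bernstein q n k a b)).
      - rewrite (sum_n_C_single _ m n hm); [ring|].
        intros j _ hj. rewrite pair_int_askey_wilson_orthogonal by auto. ring.
      - intros j hj. apply (xpoly_le (S j)); [lia|]. now apply xpoly_askey_wilson.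
      - now apply xpoly_askey_wilson.
      - exact he. }
    rewrite moment in e.
    transitivity (Cm m * hnorm q a b c d m / hnorm q a b c d m); [field; exact hnz|].
    rewrite <- e. field. exact hnz.
Qed.
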